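(* Let $\mu$ be a probability measure on $\mathbb{C}$ with compact support, and let $X_1, X_2, \ldots$ be iid random variables with distribution $\mu$. Let $k \ge 1$ and let $\xi_1, \ldots, \xi_k$ be deterministic complex numbers not depending on $n$; suppose exactly $s$ of them, namely $\xi_1, \ldots, \xi_s$, lie outside $\operatorname{supp}(\mu) \cup M_\mu$. Then there exists $\varepsilon_0 > 0$ such that for every fixed $0 < \varepsilon < \varepsilon_0$ the following holds: almost surely, for all sufficiently large $n$, the polynomial \[ p_n(z) := \prod_{j=1}^{n-k} (z - X_j) \prod_{l=1}^{k} (z - \xi_l) \] has exactly $s$ critical points (counted with multiplicity) outside $N_\mu(\varepsilon)$, and these can be labeled $w_1(p_n), \ldots, w_s(p_n)$ so that $\max_{1\le l\le s}|w_l(p_n) - \xi_l| \to 0$ as $n \to \infty$.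
   Context: For a probability measure $\mu$ on $\mathbb{C}$, $m_\mu(z) := \int_{\mathbb{C}} \frac{d\mu(x)}{z-x}$ for $z \notin \operatorname{supp}(\mu)$; $M_\mu := \{ z \in \mathbb{C}\setminus \operatorname{supp}(\mu) : m_\mu(z) = 0\}$; and $N_\mu(\varepsilon) := \{ z \in \mathbb{C} : \operatorname{dist}(z, \operatorname{supp}(\mu) \cup M_\mu) < \varepsilon\}$. A critical point of a polynomial is a zero of its derivative. *)

(* Defs.v *)
From HB Require Import structures.
From mathcomp Require Import all_boot all_order all_algebra.
From mathcomp Require Import all_classical all_reals all_analysis.
From mathcomp Require Import complex.
Set Implicit Arguments. Unset Strict Implicit. Unset Printing Implicit Defensive.
Import Order.TTheory GRing.Theory Num.Theory.
Import numFieldNormedType.Exports.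
Local Open Scope classical_set_scope.
Local Open Scope ring_scope.

Section Defs.
Variable R : realType.

Definition toC (x : R * R) : R[i] := Complex x.1 x.2.

Definition supp (mu : {measure set (R * R) -> \bar R}) : set R[i] :=
  [set z | forall r : R, 0 < r -> (0 < mu [set y | (`|toC y - z| < (r%:C)%C)%R])%E].

Definition cauchy_tr (mu : {measure set (R * R) -> \bar R}) (z : R[i]) : R[i] :=
  Complex (Rintegral mu setT (fun y => complex.Re ((z - toC y)^-1)))
          (Rintegral mu setT (fun y => complex.Im ((z - toC y)^-1))).

Definition Mzeros (mu : {measure set (R * R) -> \bar R}) : set R[i] :=
  [set z | ~ supp mu z /\ cauchy_tr mu z = 0].

Definition Nbhd (mu : {measure set (R * R) -> \bar R}) (eps : R) : set R[i] :=
  [set z | exists2 w, (supp mu `|` Mzeros mu) w & `|z - w| < (eps%:C)%C].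

(* The critical points of p (zeros of p^`(), with multiplicity) lying outside
   A are exactly w_0, ..., w_{s-1} (as a multiset). *)
Definition crit_outside (p : {poly R[i]}) (A : set R[i]) (s : nat)
    (w : 'I_s -> R[i]) : Prop :=
  p^`() != 0 /\ (forall l, ~ A (w l)) /\
  (forall z, ~ A z -> mup z p^`() = #|[pred l | w l == z]|).

Definition iid_with d (Omega : measurableType d) (P : probability Omega R)
    (X : nat -> {mfun Omega >-> (R * R)%type}) (mu : probability (R * R)%type R) : Prop :=
  (forall i (A : set (R * R)), measurable A -> P (X i @^-1` A) = mu A) /\
  (forall (I : seq nat) (A : nat -> set (R * R)), uniq I ->
     (forall i, measurable (A i)) ->
     P (\bigcap_(i in [set` I]) (X i @^-1` A i)) =
     (\prod_(i <- I) P (X i @^-1` A i))%E).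

Definition pn d (Omega : measurableType d) (X : nat -> Omega -> R * R)
    (k : nat) (xi : 'I_k -> R[i]) (n : nat) (om : Omega) : {poly R[i]} :=
  (\prod_(j < n - k) ('X - (toC (X j om))%:P)) *
  (\prod_(l < k) ('X - (xi l)%:P)).

End Defs.

(* Main.v *)
(** The critical points of [p_n] that are not roots are the zeros of the
    logarithmic derivative [p_n' / p_n].  The sum of the [1 / (z - X_j)] divided
    by [n] converges almost surely to [m_mu], uniformly at distance at least
    [eps] from the support: cutting the support into finitely many small cells
    reduces this to the strong law for the indicators of the cells.  Since
    [|m_mu|] is bounded below on the bounded part of the complement of
    [N_mu(eps)], and the logarithmic derivative cannot vanish at a point more
    than twice as large as every root, there is no critical point outside
    [N_mu(eps)] except close to an outlying root.  Around an outlying root [xi]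
    of multiplicity [m], write [p_n = ('X - xi) ^+ m * q]; then
    [p_n' = ('X - xi) ^+ (m - 1) * (m q + ('X - xi) q')], and the zeros of the
    second factor near [xi] are the fixed points of [z |-> xi - m q(z) / q'(z)].
    This map is a contraction because [|q' / q|] is of order [n], so there is
    exactly one such zero; it is simple and at distance [O(1 / n)] from [xi]. *)

Require Import Defs.
From HB Require Import structures.
From mathcomp Require Import all_boot all_order all_algebra.
From mathcomp Require Import all_classical all_reals all_analysis.
From mathcomp Require Import measurable_realfun complex ring lra zify.
Import Order.TTheory GRing.Theory Num.Theory.
Import numFieldNormedType.Exports.
Import ComplexField.Normc.
Local Open Scope classical_set_scope.
Local Open Scope ring_scope.
Set Implicit Arguments. Unset Strict Implicit. Unset Printing Implicit Defensive.

(** * Logarithmic derivatives and critical points near a root *)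

Section Modulus.
Variable R : realType.
Implicit Types x y z : R[i].

Lemma normrcE z : `|z| = (normc z)%:C%C.
Proof. by case: z. Qed.

Lemma normc_lt z (r : R) : (`|z| < r%:C%C) = (normc z < r).
Proof. by rewrite normrcE ltcR. Qed.

Lemma normc_ge0 z : 0 <= normc z.
Proof. by rewrite -lecR -normrcE normr_ge0. Qed.

Lemma normc_gt0 z : (0 < normc z) = (z != 0).
Proof. by rewrite -ltcR -normrcE normr_gt0. Qed.

Lemma ler_normcD x y : normc (x + y) <= normc x + normc y.
Proof. exact: le_normcD. Qed.

Lemma normcBC x y : normc (x - y) = normc (y - x).
Proof. by rewrite -opprB normcN. Qed.

Lemma ler_normc_dist y x z : normc (x - z) <= normc (x - y) + normc (y - z).
Proof. by rewrite (le_trans _ (ler_normcD _ _))// addrA subrK. Qed.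

Lemma ler_normc_sub x y : normc x - normc y <= normc (x + y).
Proof. by rewrite lerBlDr -{1}(addrK y x) -(normcN y) ler_normcD. Qed.

Lemma ler_normc_sum (I : Type) (s : seq I) (P : pred I) (F : I -> R[i]) :
  normc (\sum_(i <- s | P i) F i) <= \sum_(i <- s | P i) normc (F i).
Proof. exact: (@ler_norm_sum R (Rcomplex R)). Qed.

Lemma normcX z n : normc (z ^+ n) = normc z ^+ n.
Proof. by elim: n => [|n IH]; rewrite ?expr0 ?normc1 // !exprS normcM IH. Qed.

Lemma normc_prod (I : Type) (s : seq I) (F : I -> R[i]) :
  normc (\prod_(i <- s) F i) = \prod_(i <- s) normc (F i).
Proof. by elim/big_rec2: _ => [|i a b _ <-]; rewrite ?normc1 ?normcM. Qed.

Lemma normc_nat n : normc (n%:R : R[i]) = n%:R.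
Proof. by apply: complexI; rewrite -normrcE normr_nat rmorph_nat. Qed.

Lemma normcR (a : R) : normc a%:C%C = `|a|.
Proof. by rewrite /= expr0n/= addr0 sqrtr_sqr. Qed.

Lemma ler_normcReIm z : normc z <= `|complex.Re z| + `|complex.Im z|.
Proof.
case: z => a b /=; have h : 0 <= `|a| + `|b| by rewrite addr_ge0.
rewrite -[leRHS](ger0_norm h) -sqrtr_sqr ler_sqrt ?exprn_ge0//.
rewrite sqrrD -!normrX !(ger0_norm (sqr_ge0 _)).
have := mulr_ge0 (normr_ge0 a) (normr_ge0 b); lra.
Qed.

Lemma normc_geRe z : `|complex.Re z| <= normc z.
Proof. by rewrite -lecR -normrcE normc_ge_Re. Qed.

Lemma normc_geIm z : `|complex.Im z| <= normc z.
Proof.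
case: z => a b /=; rewrite -sqrtr_sqr ler_sqrt ?addr_ge0 ?sqr_ge0//.
by rewrite lerDr sqr_ge0.
Qed.

End Modulus.

Section LogDerivative.
Variable F : fieldType.
Implicit Types (a : seq F) (z : F).

Definition logder a z : F := \sum_(x <- a) (z - x)^-1.

Definition logder2 a z : F := \sum_(x <- a) (z - x)^-2.

Definition prodX a : {poly F} := \prod_(x <- a) ('X - x%:P).

Lemma deriv_prodX a z : z \notin a ->
  (prodX a)^`().[z] = (prodX a).[z] * logder a z.
Proof.
rewrite /prodX /logder; elim: a => [|x a IH].
  by rewrite !big_nil derivC horner0 mulr0.
rewrite inE negb_or => /andP[zx /IH {}IH]; rewrite !big_cons derivM derivXsubC.
have zx0 : z - x != 0 by rewrite subr_eq0.
rewrite mul1r hornerD !hornerM IH hornerXsubC mulrDr; congr (_ + _).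
  by rewrite mulrAC divff// mul1r.
by rewrite mulrA.
Qed.

(** Differentiating [p' = p * logder] once more gives [p'' = p * (logder ^+ 2 + logder')], and the
    derivative of [logder] is [- logder2]. *)
Lemma deriv2_prodX a z : z \notin a ->
  (prodX a)^`()^`().[z] = (prodX a).[z] * (logder a z ^+ 2 - logder2 a z).
Proof.
elim: a => [|x a IH].
  by rewrite /prodX /logder /logder2 !big_nil derivC deriv0 horner0 expr0n subr0 mulr0.
rewrite inE negb_or => /andP[zx za].
have zx0 : z - x != 0 by rewrite subr_eq0.
have -> : prodX (x :: a) = ('X - x%:P) * prodX a by rewrite /prodX big_cons.
have -> : logder (x :: a) z = (z - x)^-1 + logder a z by rewrite /logder big_cons.
have -> : logder2 (x :: a) z = (z - x)^-2 + logder2 a z by rewrite /logder2 big_cons.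
have := hornerXsubC x z; have := derivXsubC x; move: ('X - _) => Y dY hY.
rewrite derivM dY mul1r derivD derivM dY mul1r.
rewrite !(hornerD, hornerM) hY IH// deriv_prodX//.
by field.
Qed.

Lemma prodX_neq0 a z : z \notin a -> (prodX a).[z] != 0.
Proof. by rewrite -rootE /prodX root_prod_XsubC. Qed.

End LogDerivative.

Section Critical.
Variable R : realType.
Implicit Types (a : seq R[i]) (z : R[i]).

Lemma ler_normc_sumconst (I : eqType) (s : seq I) (F : I -> R[i]) (B : R) :
  (forall i, i \in s -> normc (F i) <= B) ->
  normc (\sum_(i <- s) F i) <= B * (size s)%:R.
Proof.
move=> FB; rewrite (le_trans (ler_normc_sum _ _ _))// big_seq.
rewrite (le_trans (ler_sum _ FB))// -big_seq big_const_seq count_predT.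
by rewrite iter_addr_0 mulr_natr.
Qed.

Lemma subrVV (F : fieldType) (u v : F) : u != 0 -> v != 0 ->
  u^-1 - v^-1 = (v - u) / (u * v).
Proof. by move=> u0 v0; field; rewrite u0 v0. Qed.

Lemma normc_subVV_le (rho : R) (u v : R[i]) : 0 < rho ->
  rho <= normc u -> rho <= normc v ->
  normc (u^-1 - v^-1) <= rho ^- 2 * normc (u - v).
Proof.
move=> r0 ru rv.
have u0 : u != 0 by rewrite -normc_gt0 (lt_le_trans r0).
have v0 : v != 0 by rewrite -normc_gt0 (lt_le_trans r0).
rewrite subrVV// normcM normcV normcM normcBC mulrC ler_wpM2r ?normc_ge0//.
rewrite lef_pV2 ?posrE ?mulr_gt0 ?exprn_gt0 ?normc_gt0//.
by rewrite expr2 ler_pM// ltW.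
Qed.

Lemma logder_lip (rho : R) a z z' : 0 < rho ->
  (forall x, x \in a -> rho <= normc (z - x)) ->
  (forall x, x \in a -> rho <= normc (z' - x)) ->
  normc (logder a z - logder a z') <= rho ^- 2 * normc (z - z') * (size a)%:R.
Proof.
move=> r0 hz hz'; rewrite /logder -sumrB; apply: ler_normc_sumconst => x xa.
rewrite (le_trans (normc_subVV_le r0 (hz _ xa) (hz' _ xa)))//.
by rewrite opprB addrA subrK.
Qed.

Lemma logder_le (rho : R) a z : 0 < rho ->
  (forall x, x \in a -> rho <= normc (z - x)) ->
  normc (logder a z) <= rho^-1 * (size a)%:R.
Proof.
move=> r0 hz; apply: ler_normc_sumconst => x xa.
by rewrite normcV lef_pV2 ?hz// posrE (lt_le_trans r0)// hz.
Qed.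

Lemma logder2_le (rho : R) a z : 0 < rho ->
  (forall x, x \in a -> rho <= normc (z - x)) ->
  normc (logder2 a z) <= rho ^- 2 * (size a)%:R.
Proof.
move=> r0 hz; apply: ler_normc_sumconst => x xa.
have h := lt_le_trans r0 (hz _ xa).
by rewrite normcV normcX lef_pV2 ?posrE ?exprn_gt0// lerXn2r ?nnegrE ?hz// ltW.
Qed.

(** What is left of the derivative of [('X - xi) ^+ m * prodX a] after [('X - xi) ^+ (m - 1)] is
    factored out. *)
Definition critpoly (xi : R[i]) m a : {poly R[i]} :=
  prodX a *+ m + ('X - xi%:P) * (prodX a)^`().

Lemma critpolyE xi m a z : z \notin a ->
  (critpoly xi m a).[z] = (prodX a).[z] * (m%:R + (z - xi) * logder a z).
Proof.
move=> za; rewrite hornerD hornerM hornerMn deriv_prodX// hornerXsubC.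
by rewrite -mulr_natr; ring.
Qed.

(** The hypothesis says that [z] is a zero of [critpoly]. Substituting [m = - (z - xi) * logder a z]
    cancels the [logder ^+ 2] coming from the second derivative. *)
Lemma deriv_critpolyE xi m a z : z \notin a ->
  m%:R + (z - xi) * logder a z = 0 ->
  (critpoly xi m a)^`().[z] =
  (prodX a).[z] * (logder a z - (z - xi) * logder2 a z).
Proof.
move=> za h; rewrite derivD derivMn derivM derivXsubC mul1r !hornerD hornerM.
rewrite hornerMn deriv2_prodX// deriv_prodX// hornerXsubC -mulr_natr.
have -> : m%:R = - ((z - xi) * logder a z) by apply/eqP; rewrite -addr_eq0 h.
by ring.
Qed.

Lemma deriv_XsubCX_prodX xi m a :
  (('X - xi%:P) ^+ m.+1 * prodX a)^`() = ('X - xi%:P) ^+ m * critpoly xi m.+1 a.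
Proof.
rewrite derivM deriv_exp derivXsubC mul1r /critpoly mulrDr mulrA -exprSr.
by rewrite mulrnAl mulrnAr.
Qed.

(* A critical point of ('X - xi)^m * prodX a near xi is a fixed point of the
   contraction z |-> xi - m / logder a z.  Existence: the values of critpoly
   along the iterates of this contraction tend to 0, whereas they would be
   bounded below by the product of the distances to the roots if none of these
   were within r of xi. *)
Lemma critpoly_unique_root (a : seq R[i]) (xi : R[i]) (m : nat) (r rho c : R) :
  0 < c -> 0 < rho -> 0 < r -> (0 < size a)%N -> (0 < m)%N ->
  (forall z, normc (z - xi) <= r -> forall x, x \in a -> rho <= normc (z - x)) ->
  (forall z, normc (z - xi) <= r -> c * (size a)%:R <= normc (logder a z)) ->
  m%:R / (c * (size a)%:R) <= r / 2 ->
  m%:R / (c * (size a)%:R) <= c * rho ^+ 2 / 2 ->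
  exists w, [/\ normc (w - xi) <= m%:R / (c * (size a)%:R), w != xi &
    forall z, normc (z - xi) <= r -> mup z (critpoly xi m a) = (z == w)].
Proof.
move=> c0 rho0 r0; set N : R := (size a)%:R => sa m0 ha hL.
set t := m%:R / _ => tr trho.
have N0 : 0 < N by rewrite ltr0n.
have cN0 : 0 < c * N by rewrite mulr_gt0.
have t0 : 0 < t by rewrite divr_gt0// ltr0n.
have mE : m%:R = t * (c * N) by rewrite /t divfK// gt_eqF.
have na z : normc (z - xi) <= r -> z \notin a.
  by move=> /ha za; apply/negP => /za; rewrite subrr normc0 leNgt rho0.
have L0 z : normc (z - xi) <= r -> 0 < normc (logder a z).
  by move=> /hL; apply: lt_le_trans.
have rtr z : normc (z - xi) <= t -> normc (z - xi) <= r.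
  by move=> /le_trans; apply; lra.
pose phi z := xi - m%:R / logder a z.
have phit z : normc (z - xi) <= r -> normc (phi z - xi) <= t.
  move=> zr; rewrite /phi addrAC subrr sub0r normcN normcM normc_nat normcV.
  by rewrite /t ler_pM2l ?ltr0n// lef_pV2 ?posrE ?hL// L0.
(* The Lipschitz bound for [logder] over denominators of size at least [(c N)^2] gives the factor
   [t / (c rho^2)], which [trho] makes at most 1/2. *)
have phil z z' : normc (z - xi) <= r -> normc (z' - xi) <= r ->
    normc (phi z - phi z') <= 2^-1 * normc (z - z').
  move=> zr zr'.
  have Lz := L0 _ zr; have Lz' := L0 _ zr'.
  have -> : phi z - phi z' =
      m%:R * (logder a z - logder a z') / (logder a z * logder a z').
    rewrite /phi; move: Lz Lz'; rewrite !normc_gt0 => ? ?; field.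
    by apply/andP.
  rewrite normcM normcV !normcM normc_nat ler_pdivrMr ?mulr_gt0//.
  have h1 := logder_lip rho0 (ha _ zr) (ha _ zr').
  have h2 : (c * N) * (c * N) <= normc (logder a z) * normc (logder a z').
    by rewrite ler_pM ?hL// ltW.
  have h3 : 0 <= 2^-1 * normc (z - z') by rewrite mulr_ge0 ?normc_ge0.
  apply: le_trans (ler_wpM2l h3 h2).
  apply: (@le_trans _ _ (m%:R * (rho ^- 2 * normc (z - z') * N))).
    by rewrite ler_wpM2l.
  have -> : m%:R * (rho ^- 2 * normc (z - z') * N) =
            (t * rho ^- 2) * (normc (z - z') * (c * N * N)) by rewrite mE; ring.
  have -> : 2^-1 * normc (z - z') * (c * N * (c * N)) =
            (c / 2) * (normc (z - z') * (c * N * N)) by ring.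
  rewrite ler_wpM2r ?mulr_ge0 ?normc_ge0 ?(ltW N0) ?(ltW c0)//.
  by rewrite ler_pdivrMr ?exprn_gt0// mulrAC.
have fixE z : normc (z - xi) <= r ->
    m%:R + (z - xi) * logder a z = logder a z * (z - phi z).
  move=> /L0; rewrite normc_gt0 => Lz; rewrite /phi; field. exact: Lz.
have rootE z : normc (z - xi) <= r -> root (critpoly xi m a) z = (phi z == z).
  move=> zr; rewrite rootE critpolyE ?na// fixE// !mulf_eq0.
  have := L0 _ zr; rewrite normc_gt0 => /negbTE ->.
  by rewrite (negbTE (prodX_neq0 (na _ zr)))/= subr_eq0 eq_sym.
have [w wr Hw] : exists2 w, normc (w - xi) <= r & root (critpoly xi m a) w.
  have xir : normc (xi - xi) <= r by rewrite subrr normc0 ltW.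
  have Hxi : (critpoly xi m a).[xi] != 0.
    rewrite critpolyE ?na// subrr mul0r addr0 mulf_neq0 ?prodX_neq0 ?na//.
    by rewrite pnatr_eq0 -lt0n.
  have H0 : critpoly xi m a != 0 by apply: contraNneq Hxi => ->; rewrite horner0.
  apply/not_exists2P => noroot.
  have [bs Hbs] := closed_field_poly_normal (critpoly xi m a).
  have bsr b : b \in bs -> r < normc (b - xi).
    move=> bbs; have [/negP|br] := noroot b; first by rewrite -ltNge.
    exfalso; apply: br; rewrite Hbs rootZ ?lead_coef_eq0//.
    by rewrite root_prod_XsubC.
  pose z j := iter j phi xi.
  have zt j : normc (z j - xi) <= t.
    elim: j => [|j IH]; first by rewrite subrr normc0 ltW.
    by rewrite /z iterS; apply/phit/rtr.
  have zr j : normc (z j - xi) <= r by exact: rtr.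
  have zphi j : normc (z j - phi (z j)) <= 2^-1 ^+ j * t.
    elim: j => [|j IH]; first by rewrite mul1r normcBC phit.
    rewrite (le_trans (phil _ _ (zr j) (zr j.+1)))// exprS -mulrA.
    by rewrite ler_pM2l ?invr_gt0.
  pose B : R := \prod_(x <- a) (r + normc (xi - x)).
  have B0 : 0 <= B by rewrite prodr_ge0// => x _; rewrite addr_ge0 ?normc_ge0// ltW.
  (* By [fixE] the value is [prodX] times [logder] times [z j - phi (z j)]; the first two factors
     are bounded on the disc and the third decays geometrically. *)
  have up j : normc (critpoly xi m a).[z j] <= (B * (rho^-1 * N) * t) * 2^-1 ^+ j.
    rewrite critpolyE ?na// fixE// !normcM.
    have -> : B * (rho^-1 * N) * t * 2^-1 ^+ j = B * (rho^-1 * N * (2^-1 ^+ j * t)).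
      by ring.
    apply: ler_pM; rewrite ?mulr_ge0 ?normc_ge0//.
      rewrite /prodX horner_prod normc_prod big_seq [leRHS]big_seq.
      apply: ler_prod => x _; rewrite normc_ge0 hornerXsubC/=.
      by rewrite (le_trans (ler_normc_dist xi _ _))// lerD2r.
    apply: ler_pM; rewrite ?normc_ge0 ?zphi// logder_le// => x xa.
    exact: ha (zr j) _ xa.
  pose D : R := normc (lead_coef (critpoly xi m a)) * (r / 2) ^+ size bs.
  have D0 : 0 < D.
    by rewrite mulr_gt0 ?exprn_gt0 ?divr_gt0// normc_gt0 lead_coef_eq0.
  (* The iterates stay within [t <= r / 2] of [xi] while every root is farther than [r], so each
     linear factor has modulus at least [r / 2]. *)
  have low j : D <= normc (critpoly xi m a).[z j].
    rewrite [in leRHS]Hbs hornerZ normcM ler_wpM2l ?normc_ge0//.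
    have -> : (r / 2) ^+ size bs = \prod_(b <- bs) (r / 2).
      by rewrite big_const_seq count_predT iter_mulr_1.
    rewrite horner_prod normc_prod.
    rewrite big_seq [leRHS]big_seq; apply: ler_prod => b /bsr rb.
    rewrite divr_ge0 ?(ltW r0)//= hornerXsubC.
    have := ler_normc_dist (z j) b xi; rewrite (normcBC b (z j)).
    by have := zt j; lra.
  pose C := B * (rho^-1 * N) * t.
  have [j Cj] : exists j, C / D < 2 ^+ j :> R.
    by exists (Num.bound (C / D)); apply: upper_nthrootP.
  have := le_trans (low j) (up j); rewrite -/C exprVn ler_pdivlMr ?exprn_gt0//.
  rewrite leNgt => /negP; apply.
  by rewrite mulrC -ltr_pdivrMr.
have uniq z : normc (z - xi) <= r -> root (critpoly xi m a) z -> z = w.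
  move=> zr; rewrite rootE// => /eqP hz; move: Hw; rewrite rootE// => /eqP hw.
  apply/eqP; rewrite -subr_eq0 -[_ == 0]negbK -normc_gt0 -leNgt.
  by have := phil _ _ zr wr; rewrite hz hw; lra.
have wt : normc (w - xi) <= t.
  by move: Hw; rewrite rootE// => /eqP {1}<-; exact: phit.
have na_w := na _ wr.
(* Simplicity of the root: [logder] has modulus at least [c N], whereas the term in [logder2] is at
   most [t N / rho^2 <= c N / 2]. *)
have Hw' : (critpoly xi m a)^`().[w] != 0.
  rewrite deriv_critpolyE//; last first.
    by rewrite fixE//; move: Hw; rewrite rootE// => /eqP ->; rewrite subrr mulr0.
  rewrite mulf_neq0 ?prodX_neq0// -normc_gt0.
  apply: lt_le_trans (ler_normc_sub _ _); rewrite normcN normcM subr_gt0.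
  apply: le_lt_trans (_ : t * (rho ^- 2 * N) < _).
    apply: ler_pM; rewrite ?normc_ge0// logder2_le// => x xa.
    exact: ha wr _ xa.
  apply: lt_le_trans (hL _ wr).
  rewrite mulrA ltr_pM2r// ltr_pdivrMr ?exprn_gt0//.
  by have := mulr_gt0 c0 (exprn_gt0 2 rho0); lra.
have H0 : critpoly xi m a != 0.
  by apply: contraNneq Hw' => ->; rewrite deriv0 horner0.
exists w; split => //.
  apply: contraTneq Hw => ->; rewrite /root critpolyE; last first.
    by rewrite na// subrr normc0 ltW.
  rewrite subrr mul0r addr0 mulf_neq0 ?pnatr_eq0 -?lt0n//.
  by rewrite prodX_neq0// na// subrr normc0 ltW.
move=> z zr; have [->{z zr}|zw] := eqVneq z w; last first.
  by rewrite mupNroot//; apply: contra zw => /(uniq _ zr) ->.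
apply/eqP; rewrite eqn_leq mup_geq// expr1 dvdp_XsubCl Hw andbT mup_leq//.
(* If the square of ['X - w] divided [critpoly], the derivative would vanish at [w]. *)
apply: contra Hw' => /dvdpP[K ->].
have : ('X - w%:P).[w] = 0 by rewrite hornerXsubC subrr.
move: ('X - _) => Y Yw; rewrite expr2 !derivM hornerD !hornerM hornerD !hornerM.
by rewrite Yw !(mulr0, mul0r, addr0).
Qed.

End Critical.

(** * A strong law for pairwise independent events *)

Section BoundedIntegral.
Context d (T : measurableType d) (R : realType) (P : probability T R).

Lemma bounded_integrable (f : T -> R) (M : R) : measurable_fun setT f ->
  (forall x, `|f x| <= M) -> P.-integrable setT (EFin \o f).
Proof.
move=> mf fM; apply: measurable_bounded_integrable => //.
  by apply: (le_lt_trans (probability_le1 P measurableT)); rewrite ltry.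
exists M; split; first by rewrite num_real.
by move=> x Mx y _; apply: le_trans (fM y) (ltW Mx).
Qed.

Lemma Rintegral_indic (A : set T) : measurable A ->
  Rintegral P setT (\1_A : T -> R) = fine (P A).
Proof. by move=> mA; rewrite /Rintegral integral_indic// setIT. Qed.

Lemma indic_integrable (A : set T) : measurable A ->
  P.-integrable setT (EFin \o (\1_A : T -> R)).
Proof.
move=> mA; apply: (@bounded_integrable _ 1) => // x.
by rewrite indicE; case: (_ \in _); rewrite ?normr1 ?normr0.
Qed.

Lemma integrable_Rsum (I : eqType) (s : seq I) (F : I -> T -> R) :
  (forall i, i \in s -> P.-integrable setT (EFin \o F i)) ->
  P.-integrable setT (EFin \o (fun x => \sum_(i <- s) F i x)) /\
  Rintegral P setT (fun x => \sum_(i <- s) F i x) =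
  \sum_(i <- s) Rintegral P setT (F i).
Proof.
elim: s => [|i s IH] Fs.
  rewrite big_nil; under eq_fun do rewrite big_nil.
  by split; [exact: integrable0|rewrite Rintegral_cst// mul0r].
have [|IH1 IH2] := IH; first by move=> j js; apply: Fs; rewrite inE js orbT.
have Fi : P.-integrable setT (EFin \o F i) by apply: Fs; rewrite mem_head.
rewrite big_cons -IH2 -RintegralD//.
under eq_fun do rewrite big_cons.
by split => //; exact: (integrableD measurableT Fi IH1).
Qed.

Lemma Rmarkov (f : T -> R) (a : R) : 0 < a -> (forall x, 0 <= f x) ->
  P.-integrable setT (EFin \o f) ->
  fine (P [set x | a <= f x]) <= Rintegral P setT f / a.
Proof.
move=> a0 f0 fi; have mf : measurable_fun setT f.
  by apply/measurable_EFinP; case/integrableP: fi.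
have mB : measurable [set x | a <= f x].
  by rewrite -[X in measurable X]setTI; exact: measurable_fun_le.
rewrite ler_pdivlMr// mulrC -(Rintegral_indic mB) -RintegralZl//; last first.
  exact: indic_integrable.
apply: le_Rintegral => //.
  apply: (@bounded_integrable _ a) => [|x].
    by apply: measurable_funM => //; exact: measurable_indic.
  by case: (_ \in _); rewrite ?mulr1 ?mulr0 ?normr0 ?gtr0_norm// ltW//.
move=> x _ /=; have [|_] := boolP (x \in _); last by rewrite mulr0.
by rewrite inE mulr1.
Qed.

(** Setting [g] to 0 on the exceptional null set gives a function bounded everywhere, with the same
    integral. *)
Lemma ae_bounded_Rintegral (g : T -> R) (M : R) : 0 <= M ->
  measurable_fun setT g -> {ae P, forall x, `|g x| <= M} ->
  P.-integrable setT (EFin \o g) /\ `|Rintegral P setT g| <= M.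
Proof.
move=> M0 mg [N [mN N0 gN]]; pose h x := g x * \1_(~` N) x.
have mh : measurable_fun setT h.
  by apply: measurable_funM => //; apply: measurable_indic; exact: measurableC.
have hM x : `|h x| <= M.
  rewrite /h indicE; have [xN|xN] := boolP (x \in ~` N); last first.
    by rewrite mulr0 normr0.
  rewrite mulr1; apply: contrapT => gx; move: xN; rewrite inE; apply.
  exact: gN.
have gh : {ae P, forall x, g x = h x}.
  exists N; split => // x /= gx; apply: contrapT => xN; apply: gx.
  by rewrite /h indicE mem_set// mulr1.
have ih : P.-integrable setT (EFin \o h) by exact: bounded_integrable hM.
have mg' : measurable_fun setT (EFin \o g) by exact/measurable_EFinP.
have mh' : measurable_fun setT (EFin \o h) by exact/measurable_EFinP.
split.
  apply/integrableP; split => //.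
  case/integrableP: ih => _; apply: le_lt_trans; rewrite le_eqVlt; apply/orP; left.
  apply/eqP/ae_eq_integral => //; [exact: measurableT_comp|exact: measurableT_comp|].
  by apply: filterS gh => x + _; rewrite /= => ->.
have -> : Rintegral P setT g = Rintegral P setT h.
  rewrite /Rintegral; congr fine; apply: ae_eq_integral => //.
  by apply: filterS gh => x + _; rewrite /= => ->.
rewrite (le_trans (le_normr_Rintegral _ ih))//.
have ic : P.-integrable setT (EFin \o (fun=> M)).
  by apply: (@bounded_integrable _ `|M|).
apply: (@le_trans _ _ (Rintegral P setT (fun=> M))).
  by apply: le_Rintegral => //; exact: integrable_norm.
have PT : P [set: T] = 1%E by exact: probability_setT.
by rewrite Rintegral_cst//= PT mulr1.
Qed.

End BoundedIntegral.

(** Serves to extend the strong law from the subsequence of squares to all indices. *)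
Lemma between_squares n : exists q, (q ^ 2 <= n < q.+1 ^ 2)%N.
Proof.
elim: n => [|n [q /andP[h1 h2]]]; first by exists 0%N.
have [|h] := ltnP n.+1 (q.+1 ^ 2)%N; first by exists q; lia.
by exists q.+1; rewrite h; lia.
Qed.

Section StrongLaw.
Context d (T : measurableType d) (R : realType) (P : probability T R).
Variables (E : nat -> set T) (p : R).
Hypothesis mE : forall i, measurable (E i).
Hypothesis PE : forall i, P (E i) = p%:E.
Hypothesis PEE : forall i j, i != j -> P (E i `&` E j) = (p * p)%:E.

Let Y i (x : T) : R := \1_(E i) x - p.
Let S n (x : T) : R := \sum_(j < n) Y j x.

Let p01 : 0 <= p <= 1.
Proof. by rewrite -!lee_fin -(PE 0) measure_ge0 probability_le1. Qed.

Let mY i : measurable_fun setT (Y i).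
Proof. by apply: measurable_funB. Qed.

Let Y1 i x : `|Y i x| <= 1.
Proof.
rewrite /Y indicE ler_norml; have /andP[? ?] := p01.
by case: (_ \in _); rewrite ?mulr1n ?mulr0n; apply/andP; split; lra.
Qed.

Let YYi i j : P.-integrable setT (EFin \o (fun x => Y i x * Y j x)).
Proof.
apply: (@bounded_integrable _ _ _ _ _ 1) => [|x].
  exact: measurable_funM.
by rewrite normrM mulr_ile1.
Qed.

Let intYY i j : Rintegral P setT (fun x => Y i x * Y j x) =
  if i == j then p * (1 - p) else 0.
Proof.
have Ii k := indic_integrable P (mE k).
have IZ k : P.-integrable setT (EFin \o (fun x => - p * \1_(E k) x)).
  exact: (integrableZl measurableT (- p) (Ii k)).
have mEE : measurable (E i `&` E j) by exact: measurableI.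
have Iij := indic_integrable P mEE.
have Ic : P.-integrable setT (EFin \o (fun=> p * p)).
  by apply: (@bounded_integrable _ _ _ _ _ `|p * p|).
rewrite (_ : (fun x => _) = (fun x => (\1_(E i `&` E j) x + - p * \1_(E i) x) +
   (- p * \1_(E j) x + p * p))); last first.
  by apply/funext => x; rewrite /Y indicI /=; ring.
rewrite RintegralD//; last 2 first.
- exact: (integrableD measurableT Iij (IZ i)).
- exact: (integrableD measurableT (IZ j) Ic).
rewrite RintegralD// RintegralD// (RintegralZl _ measurableT (Ii i)).
rewrite (RintegralZl _ measurableT (Ii j)) (Rintegral_indic P mEE).
rewrite !(Rintegral_indic P (mE _)).
have PT : P [set: T] = 1%E by exact: probability_setT.
rewrite Rintegral_cst// !PE /= PT /=.
have [->|ij] := eqVneq i j; first by rewrite setIid PE /=; ring.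
by rewrite PEE//=; ring.
Qed.

(** Pairwise independence kills the cross terms, and each of the [n] diagonal terms is the variance
    [p * (1 - p) <= 1]. *)
Let intS2 n : P.-integrable setT (EFin \o (fun x => S n x ^+ 2)) /\
  Rintegral P setT (fun x => S n x ^+ 2) <= n%:R.
Proof.
have -> : (fun x => S n x ^+ 2) =
    (fun x => \sum_(i <- enum 'I_n) \sum_(j <- enum 'I_n) Y i x * Y j x).
  apply/funext => x; rewrite expr2 /S -!big_enum/= mulr_suml.
  by apply: eq_bigr => i _; rewrite mulr_sumr.
have h (i : 'I_n) := integrable_Rsum (fun (j : 'I_n) (_ : j \in enum 'I_n) => YYi i j).
have [|h1 ->] := @integrable_Rsum _ _ _ P _ (enum 'I_n)
   (fun i x => \sum_(j <- enum 'I_n) Y i x * Y j x).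
  by move=> i _; exact: (h i).1.
split=> //; rewrite big_enum/=.
apply: (@le_trans _ _ (\sum_(i < n) 1)); last by rewrite sumr_const card_ord.
apply: ler_sum => i _; rewrite (h i).2 big_enum/= (bigD1 i)//= big1 ?addr0.
  by rewrite intYY eqxx; have := p01; nra.
by move=> j; rewrite -val_eqE eq_sym intYY /= => /negbTE ->.
Qed.

Let S_lip q m x : `|S (q + m) x| <= `|S q x| + m%:R.
Proof.
rewrite /S big_split_ord/= (le_trans (ler_normD _ _))// lerD2l.
rewrite (le_trans (ler_norm_sum _ _ _))// (le_trans (ler_sum _ (fun i _ => Y1 _ _)))//.
by rewrite sumr_const card_ord.
Qed.

(** Second moments and Borel-Cantelli control the sums at the squares [q ^ 2]; between consecutive
    squares the sum moves by at most [2 q], which is negligible against [q ^ 2]. *)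
Lemma strong_law_pairwise (e : R) : 0 < e ->
  {ae P, forall x, exists N, forall n, (N <= n)%N ->
    `|\sum_(j < n) (\1_(E j) x - p)| <= e * n%:R}.
Proof.
(* Half of [e] is spent at the squares, the other half on the gaps between them. *)
move=> e0; pose F k := [set x | ((e / 2) * (k.+1 ^ 2)%:R) ^+ 2 <= S (k.+1 ^ 2) x ^+ 2].
have e20 : 0 < e / 2 by rewrite divr_gt0.
have mF k : measurable (F k).
  have mS : measurable_fun setT (fun x => S (k.+1 ^ 2) x ^+ 2).
    by apply/measurable_EFinP; case/integrableP: (intS2 (k.+1 ^ 2)).1.
  have := measurable_fun_le measurableT
    (measurable_cst (((e / 2) * (k.+1 ^ 2)%:R) ^+ 2)) mS.
  by rewrite setTI.
(* With [u = k + 1], Markov gives [(e / 2)^-2 / u^2], and [1 / u^2 <= 2 (1 / u - 1 / (u + 1))] for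
   [u >= 1] makes the series telescope. *)
have PF k : (P (F k) <= ((e / 2) ^- 2 * 2 * (k.+1%:R^-1 - k.+2%:R^-1))%:E)%E.
  have a0 : 0 < ((e / 2) * (k.+1 ^ 2)%:R) ^+ 2.
    by rewrite exprn_gt0// mulr_gt0// ltr0n expn_gt0.
  have := Rmarkov a0 (fun x => sqr_ge0 _) (intS2 (k.+1 ^ 2)).1.
  rewrite -lee_fin fineK ?fin_num_measure//; last exact: mF. move=> /le_trans; apply.
  rewrite lee_fin ler_pdivrMr// (le_trans (intS2 _).2)//.
  rewrite -[k.+2]addn1 natrD natrX.
  have : 0 < k.+1%:R :> R by rewrite ltr0n.
  have : 1 <= k.+1%:R :> R by rewrite ler1n.
  move: (k.+1%:R : R) => u u1 u0.
  have -> : (e / 2) ^- 2 * 2 * (u^-1 - (u + 1%:R)^-1) * ((e / 2) * u ^+ 2) ^+ 2 =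
     u ^+ 2 * ((2 * u) / (u + 1)).
    by field; rewrite !gt_eqF// ltr_wpDr.
  rewrite -[leLHS]mulr1 ler_wpM2l ?sqr_ge0// ler_pdivlMr; lra.
have h0 : P (lim_sup_set F) = 0%E.
  apply: lim_sup_set_cvg0 => //.
  apply: (@le_lt_trans _ _ ((e / 2) ^- 2 * 2)%:E); last by rewrite ltry.
  apply: lime_le; first exact: is_cvg_nneseries.
  apply: nearW => n.
  apply: (@le_trans _ _ (\sum_(0 <= k < n)
    ((e / 2) ^- 2 * 2 * (k.+1%:R^-1 - k.+2%:R^-1))%:E)%E).
    by apply: lee_sum => k _; exact: PF.
  rewrite sumEFin lee_fin -mulr_sumr ler_piMr//.
    by rewrite mulr_ge0// invr_ge0 sqr_ge0.
  have -> : \sum_(0 <= k < n) (k.+1%:R^-1 - k.+2%:R^-1) = 1 - n.+1%:R^-1 :> R.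
    elim: n => [|n IH]; first by rewrite big_geq// invr1 subrr.
    by rewrite big_nat_recr//= IH addrA subrK.
  by rewrite gerBl invr_ge0.
exists (lim_sup_set F); split => //.
  by apply: bigcap_measurable => // n _; exact: bigcup_measurable.
move=> x /=; apply: contra_notP => nlim.
have [K hK] : exists K, forall k, (K <= k)%N -> ~ F k x.
  apply: contrapT => /forallNP hK; apply: nlim => n _.
  have /existsNP[k /not_implyP[nk /contrapT Fk]] := hK n.
  by exists k.
have [M hM] : exists M : nat, 2 / (e / 2) < M%:R.
  by exists (Num.bound (2 / (e / 2))); rewrite archi_boundP// divr_ge0// ltW.
(* This forces [q >= K + 2 + M]. Then [F q.-1], the event at the square [q ^ 2], is avoided, and
   [q >= M] gives [2 q <= (e / 2) q^2]. *)
exists ((K.+2 + M) ^ 2)%N => n hn.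
have [q /andP[q1 q2]] := between_squares n.
have qK : (K.+2 + M <= q)%N.
  by rewrite -ltnS -(@ltn_exp2r _ _ 2)//; exact: leq_ltn_trans q2.
have := hK q.-1; rewrite /F/= (@prednK q); last by lia.
have -> : (K <= q.-1)%N by lia.
move=> /(_ isT) /negP; rewrite -ltNge -(real_normK (num_real (S (q ^ 2) x))).
rewrite ltr_pXn2r ?nnegrE// ?(mulr_ge0 (ltW e20))// => Sq.
have := S_lip (q ^ 2) (n - q ^ 2) x; rewrite subnKC// => /le_trans; apply.
have h1 : (n - q ^ 2)%:R <= 2 * q%:R :> R.
  by rewrite -natrM ler_nat; move: q1 q2; rewrite -!mulnn; lia.
have h2 : 2 * q%:R <= e / 2 * (q ^ 2)%:R :> R.
  have : 2 / (e / 2) <= q%:R :> R.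
    by rewrite (le_trans (ltW hM))// ler_nat; lia.
  rewrite ler_pdivrMr// natrX expr2 => h; rewrite mulrA ler_wpM2r//.
  by rewrite mulrC.
have h3 : (q ^ 2)%:R <= n%:R :> R by rewrite ler_nat.
have := ler_wpM2l (ltW e0) h3; lra.
Qed.

End StrongLaw.

(** * Support and Cauchy transform *)

Definition disc (R : realType) (z : R[i]) (r : R) : set (R * R) :=
  [set y | normc (toC y - z) < r].

Section Support.
Variable R : realType.
Variable mu : probability (R * R)%type R.
Implicit Types (z w : R[i]) (y : (R * R)%type).

Lemma suppP z : supp mu z <-> forall r : R, 0 < r -> (0 < mu (disc z r))%E.
Proof.
have e r : [set y | (`|toC y - z| < (r%:C)%C)%R] = disc z r.
  by apply/seteqP; split=> y /=; rewrite normc_lt.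
by split=> h r r0; [rewrite -e|rewrite e]; exact: h.
Qed.

Lemma measurable_disc z r : measurable (disc z r).
Proof.
have [r0|r0] := leP r 0.
  rewrite (_ : disc z r = set0)//; apply/seteqP; split => // y /=.
  by rewrite /disc/= ltNge (le_trans r0)// normc_ge0.
have -> : disc z r = ~` (setT `&` [set y : R * R | cst (r ^+ 2) y <=
    (y.1 - complex.Re z) ^+ 2 + (y.2 - complex.Im z) ^+ 2]).
  apply/seteqP; rewrite setTI; split => y; rewrite /disc /toC/=;
    case: z => a b /=; rewrite -[r in _ < r](gtr0_norm r0) -sqrtr_sqr.
    by rewrite ltr_sqrt ?exprn_gt0// => /lt_geF ->.
  by move=> /negP; rewrite -ltNge ltr_sqrt ?exprn_gt0.
apply: measurableC; apply: measurable_fun_le => //.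
apply: measurable_funD; apply: measurable_funX; apply: measurable_funB => //.
Qed.

Lemma normc_toC_lt y y' (s : R) : `|y.1 - y'.1| < s -> `|y.2 - y'.2| < s ->
  normc (toC y - toC y') < 2 * s.
Proof.
move=> h1 h2; apply: le_lt_trans (ler_normcReIm _) _.
by rewrite /toC /=; lra.
Qed.

(** A point outside the support is the centre of a null disc, hence lies in a null square with
    rational centre and half-side. There are only countably many such squares. *)
Lemma supp_ae : {ae mu, forall y, supp mu (toC y)}.
Proof.
pose Q (q : rat * rat * rat) : set (R * R) :=
  [set y | `|y.1 - ratr q.1.1| < ratr q.2 /\ `|y.2 - ratr q.1.2| < ratr q.2].
have mQ q : measurable (Q q).
  have -> : Q q = `]ratr q.1.1 - ratr q.2, ratr q.1.1 + ratr q.2[%classic `*`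
             `]ratr q.1.2 - ratr q.2, ratr q.1.2 + ratr q.2[%classic.
    apply/seteqP; split=> y; rewrite /Q /= !in_itv/= !ltr_distl; first by case.
    by case.
  exact: measurableX.
(* Enumerates the null rational squares; the empty set stands for integers that code no square or a
   square of positive measure. *)
pose G n := if unpickle n is Some q then
   (if mu (Q q) == 0%E then Q q else set0) else set0.
have G0 n : mu.-negligible (G n).
  rewrite /G; case: unpickle => [q|]; last exact: negligible_set0.
  case: eqP => [q0|_]; last exact: negligible_set0.
  by apply/negligibleP.
apply: negligibleS (negligible_bigcup G0) => y /= /suppP.
move=> /existsNP[r /not_implyP[r0 /negP]]; rewrite -leNgt => mur.
(* With half-side below [r / 4], two points of the square differ by less than [r / 2] in each
   coordinate, so by less than [r] in modulus. *)
have r40 : 0 < r / 4 by rewrite divr_gt0.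
have [s] := rat_in_itvoo r40; rewrite in_itv/= => /andP[s0 sr].
have nearq (x : R) : exists q : rat, `|x - ratr q| < ratr s.
  have [q] := @rat_in_itvoo R (x - ratr s) (x + ratr s) ltac:(lra).
  by rewrite in_itv/= => /andP[? ?]; exists q; rewrite ltr_distlC; apply/andP.
have [a ya] := nearq y.1; have [b yb] := nearq y.2.
exists (pickle (a, b, s)); first exact: I.
rewrite /G pickleK ifT; first by split.
have sub : Q (a, b, s) `<=` disc (toC y) r.
  move=> y' [/= h1 h2]; rewrite /disc /=.
  have k1 := ler_distD (ratr a) y'.1 y.1; rewrite (distrC (ratr a)) in k1.
  have k2 := ler_distD (ratr b) y'.2 y.2; rewrite (distrC (ratr b)) in k2.
  apply: lt_le_trans (normc_toC_lt (s := r / 2) _ _) _; lra.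
rewrite eq_le measure_ge0 andbT (le_trans _ mur)//.
by apply: le_measure => //; rewrite inE//; exact: measurable_disc.
Qed.

(** A null disc of radius [r] about [z] contains the disc of radius [r / 2] about any [w] closer
    than [r / 2], so such a [w] is not in the support. *)
Lemma supp_open z : ~ supp mu z -> exists2 r : R, 0 < r &
  forall w, supp mu w -> r <= normc (z - w).
Proof.
move=> /suppP /existsNP[r /not_implyP[r0 /negP]]; rewrite -leNgt => mur.
exists (r / 2); first by rewrite divr_gt0.
move=> w /suppP /(_ (r / 2) ltac:(lra)); rewrite leNgt => h.
apply/negP => zw; move: h; rewrite ltNge => /negP; apply.
rewrite (le_trans _ mur)// le_measure ?inE//; [exact: measurable_disc..|].
move=> y; rewrite /disc/= => h.
by have := ler_normc_dist w (toC y) z; rewrite (normcBC w); lra.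
Qed.

End Support.

(** * Regularity and lower bounds of the Cauchy transform *)

Section CauchyTransform.
Variable R : realType.
Variable mu : probability (R * R)%type R.
Implicit Types (z w : R[i]) (y : (R * R)%type).

Lemma measurable_sqsum_inv z : measurable_fun setT (fun y : R * R =>
  ((complex.Re z - y.1) ^+ 2 + (complex.Im z - y.2) ^+ 2)^-1).
Proof.
(* The base is nonnegative, so the inverse is the real power of exponent -1, also at 0, and
   measurability of powers applies. *)
rewrite (_ : (fun y => _) = (fun y : R * R => 
   ((complex.Re z - y.1) ^+ 2 + (complex.Im z - y.2) ^+ 2) `^ (-1))); last first.
  by apply/funext => x; rewrite powR_inv1 ?addr_ge0 ?sqr_ge0.
apply: (measurableT_comp (measurable_powR _)).
apply: measurable_funD; apply: measurable_funX; apply: measurable_funB => //.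
Qed.

Lemma measurable_ReV z : measurable_fun setT (fun y => complex.Re ((z - toC y)^-1)).
Proof.
rewrite (_ : (fun y => _) = (fun y : R * R => (complex.Re z - y.1) *
   ((complex.Re z - y.1) ^+ 2 + (complex.Im z - y.2) ^+ 2)^-1)); last first.
  by apply/funext => y; case: z.
apply: measurable_funM; last exact: measurable_sqsum_inv.
by apply: measurable_funB.
Qed.

Lemma measurable_ImV z : measurable_fun setT (fun y => complex.Im ((z - toC y)^-1)).
Proof.
rewrite (_ : (fun y => _) = (fun y : R * R => - (complex.Im z - y.2) *
   ((complex.Re z - y.1) ^+ 2 + (complex.Im z - y.2) ^+ 2)^-1)); last first.
  by apply/funext => y; case: z => a b; rewrite mulNr.
apply: measurable_funM; last exact: measurable_sqsum_inv.
by apply: measurable_funN; apply: measurable_funB.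
Qed.


(** Distance at least [eps] from the support alone, without [Mzeros]: this is what the bounds on
    [(z - w)^-1] require. *)
Definition far (eps : R) z := forall w, supp mu w -> eps <= normc (z - w).

Lemma Re_sum (I : Type) (s : seq I) (F : I -> R[i]) :
  complex.Re (\sum_(i <- s) F i) = \sum_(i <- s) complex.Re (F i).
Proof. by apply: (big_morph (@complex.Re R)) => // -[a b] [c d]. Qed.

Lemma Im_sum (I : Type) (s : seq I) (F : I -> R[i]) :
  complex.Im (\sum_(i <- s) F i) = \sum_(i <- s) complex.Im (F i).
Proof. by apply: (big_morph (@complex.Im R)) => // -[a b] [c d]. Qed.

Lemma ReB z w : complex.Re (z - w) = complex.Re z - complex.Re w.
Proof. by case: z w => [a b] [c d]. Qed.

Lemma ImB z w : complex.Im (z - w) = complex.Im z - complex.Im w.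
Proof. by case: z w => [a b] [c d]. Qed.

Lemma ReZ (a : R) z : complex.Re (a%:C%C * z) = a * complex.Re z.
Proof. by case: z => [b c] /=; rewrite mul0r subr0. Qed.

Lemma ImZ (a : R) z : complex.Im (a%:C%C * z) = a * complex.Im z.
Proof. by case: z => [b c] /=; rewrite mul0r addr0. Qed.

Lemma farVle (eps : R) z w : 0 < eps -> far eps z -> supp mu w ->
  normc ((z - w)^-1) <= eps^-1.
Proof.
move=> e0 fz /fz ew; rewrite normcV lef_pV2//.
by rewrite posrE (lt_le_trans e0).
Qed.

Lemma far_integrable (eps : R) z : 0 < eps -> far eps z ->
  mu.-integrable setT (EFin \o (fun y => complex.Re ((z - toC y)^-1))) /\
  mu.-integrable setT (EFin \o (fun y => complex.Im ((z - toC y)^-1))).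
Proof.
move=> e0 fz; have V0 : 0 <= eps^-1 by rewrite invr_ge0 ltW.
have [|iR _] := @ae_bounded_Rintegral _ _ _ mu _ _ V0 (measurable_ReV z).
  apply: filterS (supp_ae mu) => y sy.
  exact: le_trans (normc_geRe _) (farVle e0 fz sy).
have [|iI _] := @ae_bounded_Rintegral _ _ _ mu _ _ V0 (measurable_ImV z).
  apply: filterS (supp_ae mu) => y sy.
  exact: le_trans (normc_geIm _) (farVle e0 fz sy).
by [].
Qed.

(** The integrand is Lipschitz with constant [eps ^- 2] for almost every point; the factor 2 comes
    from estimating real and imaginary parts separately. *)
Lemma cauchy_tr_lip (eps : R) z z' : 0 < eps -> far eps z -> far eps z' ->
  normc (cauchy_tr mu z - cauchy_tr mu z') <= 2 * (eps ^- 2 * normc (z - z')).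
Proof.
move=> e0 fz fz'; set L := _ * normc _.
have L0 : 0 <= L by rewrite mulr_ge0 ?normc_ge0// invr_ge0 sqr_ge0.
have [iR iI] := far_integrable e0 fz; have [iR' iI'] := far_integrable e0 fz'.
have dL w : supp mu w -> normc ((z - w)^-1 - (z' - w)^-1) <= L.
  move=> sw; apply: le_trans (normc_subVV_le e0 (fz _ sw) (fz' _ sw)) _.
  by rewrite opprB addrA subrK.
apply: le_trans (ler_normcReIm _) _; rewrite ReB ImB /=.
rewrite -!RintegralB// mulr2n mulrDl !mul1r lerD//.
- apply: (ae_bounded_Rintegral L0 _ _).2.
    by apply: measurable_funB; exact: measurable_ReV.
  apply: filterS (supp_ae mu) => y sy; rewrite -ReB.
  exact: le_trans (normc_geRe _) (dL _ sy).
- apply: (ae_bounded_Rintegral L0 _ _).2.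
    by apply: measurable_funB; exact: measurable_ImV.
  apply: filterS (supp_ae mu) => y sy; rewrite -ImB.
  exact: le_trans (normc_geIm _) (dL _ sy).
Qed.

(** Near a point off the support where the transform is nonzero, its Lipschitz continuity excludes
    zeros. *)
Lemma supp_Mzeros_open z : ~ (supp mu `|` Mzeros mu) z -> exists2 r : R, 0 < r &
  forall w, (supp mu `|` Mzeros mu) w -> r <= normc (z - w).
Proof.
move=> /not_orP[nz mz]; have [r r0 fz] := supp_open nz.
have m0 : 0 < normc (cauchy_tr mu z).
  by rewrite normc_gt0; apply/eqP => m0; apply: mz.
have r20 : 0 < r / 2 by rewrite divr_gt0.
(* For [w] within [q] of [z], the Lipschitz bound at distance [r / 2] from the support is below half
   the modulus of the transform at [z]. *)
pose q := normc (cauchy_tr mu z) * (r / 2) ^+ 2 / 4.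
have q0 : 0 < q by rewrite /q divr_gt0// mulr_gt0// exprn_gt0.
exists (Num.min (r / 2) q); first by rewrite lt_min r20.
move=> w [sw|[nw mw]]; rewrite ge_min; first by have := fz _ sw; lra.
apply/orP; have [h|wr] := leP (r / 2) (normc (z - w)); [by left|right].
rewrite leNgt; apply/negP => wq.
have fz2 : far (r / 2) z by move=> v /fz; lra.
have fw2 : far (r / 2) w.
  by move=> v /fz; have := ler_normc_dist w z v; lra.
have := cauchy_tr_lip r20 fz2 fw2; rewrite mw subr0 leNgt => /negP; apply.
rewrite mulrCA ltr_pdivrMl ?exprn_gt0//.
by move: wq; rewrite /q; nra.
Qed.

Lemma notin_Nbhd (eps : R) z : ~ Nbhd mu eps z <->
  forall w, (supp mu `|` Mzeros mu) w -> eps <= normc (z - w).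
Proof.
split=> [nz w Fw|h [w Fw]].
  by rewrite leNgt; apply/negP => zw; apply: nz; exists w; rewrite ?normc_lt.
by rewrite normc_lt ltNge h.
Qed.

(** Compactness of a box containing the disc of radius [B]. Near a point of the open set
    [Nbhd mu eps] the bound is vacuous; near any other point the transform keeps at least half of
    its nonzero modulus. *)
Lemma cauchy_tr_bounded_below (eps B : R) : 0 < eps ->
  exists2 c : R, 0 < c & forall z, ~ Nbhd mu eps z -> normc z <= B ->
    c <= normc (cauchy_tr mu z).
Proof.
move=> e0; pose K := (`[- B, B]%classic `*` `[- B, B]%classic) : set (R * R).
have cK : compact K by apply: compact_setX; exact: segment_compact.
pose Q (c : R) (y : R * R) := ~ Nbhd mu eps (toC y) -> c <= normc (cauchy_tr mu (toC y)).
(* The local bounds hold for all small positive [c], so the covering form of compactness yields one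
   [c] for the whole box. *)
have : \forall c \near 0^'+, K `<=` Q c.
  apply: (compact_near_coveringP K).1 => // x Kx.
  have ballx (s : R) : 0 < s -> \forall x' \near x, normc (toC x - toC x') < s.
    move=> s0; apply: filterS (nbhsx_ballx x (s / 2) _); last by rewrite divr_gt0.
    move=> y [y1 y2]; apply: lt_le_trans (normc_toC_lt (s := s / 2) y1 y2) _; lra.
  have [[w Fw xw]|nx] := pselect (Nbhd mu eps (toC x)).
    rewrite normc_lt in xw.
    have d0 : 0 < eps - normc (toC x - w) by rewrite subr_gt0.
    exists ([set x' | normc (toC x - toC x') < eps - normc (toC x - w)], setT).
      by split; [exact: ballx|exact: filterT].
    move=> [x' c] [h _].
    have {}h : normc (toC x - toC x') < eps - normc (toC x - w) := h.
    rewrite /Q/snd/fst => /notin_Nbhd /(_ _ Fw).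
    have := ler_normc_dist (toC x) (toC x') w; rewrite (normcBC (toC x') (toC x)). lra.
  have fx := (notin_Nbhd eps (toC x)).1 nx.
  have m0 : 0 < normc (cauchy_tr mu (toC x)).
    rewrite normc_gt0; apply/eqP => m0.
    have Fx : (supp mu `|` Mzeros mu) (toC x).
      by right; split => // sx; have := fx _ (or_introl sx); rewrite subrr normc0; lra.
    by have := fx _ Fx; rewrite subrr normc0; lra.
  set a := normc _ in m0.
  have s0 : 0 < a * eps ^+ 2 / 4 by rewrite divr_gt0// mulr_gt0// exprn_gt0.
  exists ([set x' | normc (toC x - toC x') < a * eps ^+ 2 / 4], [set c | c < a / 2]).
    split; first exact: ballx.
    by apply: nbhs_right_lt; rewrite divr_gt0.
  move=> [x' c] [h ca]; have {}h : normc (toC x - toC x') < a * eps ^+ 2 / 4 := h.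
  have {}ca : c < a / 2 := ca; rewrite /Q/snd/fst => nx'.
  have fx' := (notin_Nbhd eps (toC x')).1 nx'.
  have := cauchy_tr_lip e0 (fun w sw => fx _ (or_introl sw))
    (fun w sw => fx' _ (or_introl sw)).
  have h2 : 2 * (eps ^- 2 * normc (toC x - toC x')) <= a / 2.
    rewrite mulrCA ler_pdivrMl ?exprn_gt0//; lra.
  have := ler_normc_sub (cauchy_tr mu (toC x))
    (cauchy_tr mu (toC x') - cauchy_tr mu (toC x)).
  rewrite subrKC -/a (normcBC (cauchy_tr mu (toC x'))); lra.
move=> /(filterI (nbhs_right_gt 0)) /filter_ex[c [/= c0 Kc]].
exists c => // -[a b] nz zB; apply: (Kc (a, b)) => //.
have h1 := le_trans (normc_geRe _) zB; have h2 := le_trans (normc_geIm _) zB.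
by split; rewrite /= in_itv/=; rewrite -ler_norml.
Qed.

End CauchyTransform.

(** * Uniform law of large numbers for the Cauchy transform *)

Section Cells.
Variable R : realType.
Variable mu : probability (R * R)%type R.
Implicit Types (z w : R[i]) (y : (R * R)%type).

(** A partition of the support into small cells, stated through the indicators that the strong law
    handles. The centres lie in the support, so that [far] bounds the distance to them too. *)
Definition is_cells K (A : 'I_K -> set (R * R)) (c : 'I_K -> R * R) (delta : R) :=
  [/\ forall i, measurable (A i), forall i, supp mu (toC (c i)) &
      forall y, supp mu (toC y) -> exists i,
        (forall j, \1_(A j) y = (j == i)%:R :> R) /\
        normc (toC y - toC (c i)) <= delta].

(** Finitely many discs about points of the support cover it; removing from each disc the earlier
    ones makes the cells disjoint. *)
Lemma supp_cells (delta : R) : compact (@toC R @^-1` supp mu) -> 0 < delta ->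
  exists K (A : 'I_K -> set (R * R)) c, is_cells A c delta.
Proof.
move=> cK d0; pose S := @toC R @^-1` supp mu; rewrite -/S in cK.
have d20 : 0 < delta / 2 by rewrite divr_gt0.
have [s [sS scov]] : exists s : seq (R * R), (forall c, c \in s -> S c) /\
    (forall y, S y -> exists2 c, c \in s & ball c (delta / 2) y).
  (* The filter of finite lists of support points, directed by inclusion, turns near-covering
     compactness into a finite subcover. Its balls are coordinatewise, whence the radius
     [delta / 2]. *)
  pose D := [set s : seq (R * R) | forall c : R * R, c \in s -> S c].
  pose Fl := filter_from D (fun s => [set s' : seq (R * R) | D s' /\ {subset s <= s'}]).
  have FFl : Filter Fl.
    apply: filter_from_filter; first by exists [::].
    move=> s t Ds Dt; exists (s ++ t).
      by move=> c; rewrite mem_cat => /orP[/Ds|/Dt].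
    by move=> s' [Ds' ss']; split; split => // c cs; apply: ss';
      rewrite mem_cat cs ?orbT.
  have : \forall s \near Fl, S `<=` (fun y => exists2 c, c \in s & ball c (delta / 2) y).
    apply: (compact_near_coveringP S).1 => // x Sx.
    exists (ball x (delta / 2), [set s : seq (R * R) | D s /\ {subset [:: x] <= s}]).
      split; first exact: nbhsx_ballx.
      by exists [:: x] => // c; rewrite inE => /eqP ->.
    move=> [y s] [xy [_ xs]]; exists x => //.
    by apply: xs; rewrite inE.
  move=> [s Ds] /(_ s) h; exists s; split => // y Sy.
  by have [|c ? ?] := h _ y Sy; [split|exists c].
pose B n := [set y | normc (toC y - toC (nth (0, 0) s n)) < delta].
have mB n : measurable (B n) by exact: measurable_disc.
pose A := seqDU B.
exists (size s), (fun i => A i), (fun i => nth (0, 0) s i); split.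
- by move=> i; exact: seqDU_measurable.
- by move=> i; apply: sS; exact: mem_nth.
move=> y /scov[c cs [yc1 yc2]].
have [n ns By] : exists2 n, (n < size s)%N & B n y.
  exists (index c s); first by rewrite index_mem.
  rewrite /B /mkset nth_index// normcBC; apply: lt_le_trans (normc_toC_lt yc1 yc2) _.
  by rewrite mulrC divfK.
have exB : exists n, `[< B n y >] by exists n; apply/asboolP.
(* The first disc containing [y] determines the only cell containing [y]. *)
have [m /asboolP Bm mmin] := ex_minnP exB.
have ms : (m < size s)%N by apply: leq_ltn_trans (mmin n _) ns; apply/asboolP.
have Am : A m y.
  split => //; rewrite -bigcup_mkord => -[j /= jm Bj].
  by have := mmin j; rewrite leqNgt jm => /(_ (asboolT Bj)).
exists (Ordinal ms); split; last exact: ltW.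
move=> j; rewrite indicE; congr (_%:R); congr nat_of_bool.
apply/idP/eqP => [|->]; last by rewrite mem_set.
rewrite inE => Aj; apply: val_inj => /=.
have /trivIsetP tA := @trivIset_seqDU _ B.
apply/eqP/negPn/negP => jm.
have : (seqDU B j `&` seqDU B m) y by split.
by rewrite (tA _ _ I I jm).
Qed.

(** The Cauchy transform of the discrete signed measure with mass [a j] at [c j]. *)
Definition cell_sum K (c : 'I_K -> R * R) (a : 'I_K -> R) z :=
  \sum_(j < K) (a j)%:C%C * (z - toC (c j))^-1.

Section Approx.
Variables (K : nat) (A : 'I_K -> set (R * R)) (c : 'I_K -> R * R) (delta eps : R).
Hypothesis cells : is_cells A c delta.
Hypothesis eps0 : 0 < eps.

Lemma cell_sum_le a z : far mu eps z ->
  normc (cell_sum c a z) <= (\sum_(j < K) `|a j|) / eps.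
Proof.
case: cells => _ sc _ fz; rewrite /cell_sum (le_trans (ler_normc_sum _ _ _))// mulr_suml.
apply: ler_sum => j _; by rewrite normcM normcR ler_wpM2l// (farVle eps0 fz).
Qed.


(** Only the cell of [y] contributes, so the sum collapses to [(z - c i)^-1] with [c i] within
    [delta] of [y]. *)
Lemma cell_approx z y : far mu eps z -> supp mu (toC y) ->
  normc ((z - toC y)^-1 - cell_sum c (fun j => \1_(A j) y) z) <= eps ^- 2 * delta.
Proof.
case: cells => _ sc dc fz sy; have [i [ei di]] := dc _ sy.
have -> : cell_sum c (fun j => \1_(A j) y) z = (z - toC (c i))^-1.
  rewrite /cell_sum (bigD1 i)//= big1 ?addr0 => [|j ji]; rewrite ei.
    by rewrite eqxx mul1r.
  by rewrite (negbTE ji) mul0r.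
apply: le_trans (normc_subVV_le eps0 (fz _ sy) (fz _ (sc i))) _.
have -> : z - toC y - (z - toC (c i)) = toC (c i) - toC y by ring.
by rewrite ler_wpM2l ?invr_ge0 ?sqr_ge0// normcBC.
Qed.

Let Gsum (I : Type) (s : seq I) (a : I -> 'I_K -> R) z :
  \sum_(i <- s) cell_sum c (a i) z = cell_sum c (fun j => \sum_(i <- s) a i j) z.
Proof.
rewrite /cell_sum exchange_big /=; apply: eq_bigr => j _.
by rewrite rmorph_sum mulr_suml.
Qed.

Let GB (a b : 'I_K -> R) z :
  cell_sum c a z - cell_sum c b z = cell_sum c (fun j => a j - b j) z.
Proof. by rewrite /cell_sum -sumrB; apply: eq_bigr => j _; rewrite rmorphB mulrBl. Qed.

(** Integrates [cell_approx] over [y], separately in real and imaginary parts, whence the factor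
    2. *)
Lemma cell_cauchy_tr z : far mu eps z ->
  normc (cauchy_tr mu z - cell_sum c (fun j => fine (mu (A j))) z) <=
  2 * (eps ^- 2 * delta).
Proof.
move=> fz; have [mA sc dc] := cells.
(* The support is nonempty because [mu] has mass 1; a point of it shows that the error bound is
   nonnegative. *)
have [y sy] : exists y, supp mu (toC y).
  apply: contrapT => /forallNP h.
  have : {ae mu, forall y : R * R, False}.
    by apply: filterS (supp_ae mu) => y /h.
  move=> /filter_ex[] //.
  apply: ae_properfilter_algebraOfSetsType.
  by apply: lt_le_trans (lte01) _; rewrite -[leLHS](probability_setT mu).
have d0 : 0 <= eps ^- 2 * delta.
  exact: le_trans (normc_ge0 _) (cell_approx fz sy).
have [iR iI] := far_integrable eps0 fz.
have iA (r : 'I_K -> R) j : j \in enum 'I_K ->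
    mu.-integrable setT (EFin \o (fun y => r j * \1_(A j) y)).
  move=> _; exact: (integrableZl measurableT (r j) (indic_integrable mu (mA j))).
have sA (r : 'I_K -> R) : \sum_(j <- enum 'I_K) fine (mu (A j)) * r j =
    Rintegral mu setT (fun y => \sum_(j <- enum 'I_K) r j * \1_(A j) y).
  rewrite (integrable_Rsum (iA r)).2; apply: eq_bigr => j _.
  rewrite RintegralZl//; last exact: indic_integrable.
  by rewrite Rintegral_indic// mulrC.
apply: le_trans (ler_normcReIm _) _; rewrite ReB ImB /cell_sum Re_sum Im_sum.
under eq_bigr do rewrite ReZ; under [in X in _ + X]eq_bigr do rewrite ImZ.
rewrite -!big_enum /=.
rewrite (sA (fun j => complex.Re (z - toC (c j))^-1)).
rewrite (sA (fun j => complex.Im (z - toC (c j))^-1)).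
have iRs := (integrable_Rsum (iA (fun j => complex.Re (z - toC (c j))^-1))).1.
have iIs := (integrable_Rsum (iA (fun j => complex.Im (z - toC (c j))^-1))).1.
rewrite -!RintegralB// mulr2n mulrDl !mul1r lerD//.
- apply: (ae_bounded_Rintegral d0 _ _).2.
    apply: measurable_funB; first exact: measurable_ReV.
    by apply/measurable_EFinP; case/integrableP: iRs.
  apply: filterS (supp_ae mu) => y' sy'.
  rewrite (_ : \sum_(j <- _) _ = complex.Re (cell_sum c (fun j => \1_(A j) y') z)).
    by rewrite -ReB; exact: le_trans (normc_geRe _) (cell_approx fz sy').
  by rewrite /cell_sum Re_sum big_enum/=; apply: eq_bigr => j _; rewrite ReZ mulrC.
- apply: (ae_bounded_Rintegral d0 _ _).2.
    apply: measurable_funB; first exact: measurable_ImV.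
    by apply/measurable_EFinP; case/integrableP: iIs.
  apply: filterS (supp_ae mu) => y' sy'.
  rewrite (_ : \sum_(j <- _) _ = complex.Im (cell_sum c (fun j => \1_(A j) y') z)).
    by rewrite -ImB; exact: le_trans (normc_geIm _) (cell_approx fz sy').
  by rewrite /cell_sum Im_sum big_enum/=; apply: eq_bigr => j _; rewrite ImZ mulrC.
Qed.

(** Moving the points to the centres costs one unit of [eps ^- 2 * delta] per point, discretising
    [mu] costs two, and the last term is the deviation of the cell frequencies, which no longer
    involves [z]. *)
Lemma cell_empirical (x : nat -> R * R) n z : far mu eps z ->
  (forall i, supp mu (toC (x i))) ->
  normc (\sum_(i < n) (z - toC (x i))^-1 - n%:R * cauchy_tr mu z) <=
  3 * (eps ^- 2 * delta) * n%:R +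
  (\sum_(j < K) `|\sum_(i < n) (\1_(A j) (x i) - fine (mu (A j)))|) / eps.
Proof.
move=> fz sx.
pose a i j : R := \1_(A j) (x i).
have h1 : normc (\sum_(i < n) ((z - toC (x i))^-1 - cell_sum c (a i) z)) <=
    (eps ^- 2 * delta) * n%:R.
  rewrite (le_trans (ler_normc_sum _ _ _))//.
  apply: (@le_trans _ _ (\sum_(i < n) eps ^- 2 * delta)).
    by apply: ler_sum => i _; exact: cell_approx.
  by rewrite sumr_const card_ord mulr_natr.
have h2 : normc (n%:R * (cell_sum c (fun j => fine (mu (A j))) z - cauchy_tr mu z)) <=
    2 * (eps ^- 2 * delta) * n%:R.
  by rewrite normcM normc_nat mulrC ler_wpM2r// normcBC cell_cauchy_tr.
have h3 := cell_sum_le (fun j => \sum_(i < n) (a i j - fine (mu (A j)))) fz.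
have -> : \sum_(i < n) (z - toC (x i))^-1 - n%:R * cauchy_tr mu z =
   \sum_(i < n) ((z - toC (x i))^-1 - cell_sum c (a i) z) +
   (n%:R * (cell_sum c (fun j => fine (mu (A j))) z - cauchy_tr mu z) +
    cell_sum c (fun j => \sum_(i < n) (a i j - fine (mu (A j)))) z).
  rewrite -Gsum sumrB; under [X in _ + (_ + X)]eq_bigr do rewrite -GB.
  by rewrite sumrB sumr_const card_ord -mulr_natl; ring.
apply: le_trans (ler_normcD _ _) _; have := ler_normcD
   (n%:R * (cell_sum c (fun j => fine (mu (A j))) z - cauchy_tr mu z))
   (cell_sum c (fun j => \sum_(i < n) (a i j - fine (mu (A j)))) z).
by move: h1 h2 h3; lra.
Qed.

End Approx.
End Cells.

(** * Almost sure convergence of the empirical Cauchy transforms *)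

Section UniformLaw.
Context (R : realType) (d : measure_display) (Omega : measurableType d).
Variables (P : probability Omega R) (mu : probability (R * R)%type R).
Variable X : nat -> {mfun Omega >-> (R * R)%type}.
Hypothesis iid : iid_with P X mu.

Lemma iid_strong_law (A : set (R * R)) (e : R) : measurable A -> 0 < e ->
  {ae P, forall om, exists N, forall n, (N <= n)%N ->
    `|\sum_(j < n) (\1_A (X j om) - fine (mu A))| <= e * n%:R}.
Proof.
move=> mA e0; have [id ind] := iid.
have mE i : measurable (X i @^-1` A).
  by rewrite -[X in measurable X]setTI; exact: measurable_funPT.
have PE i : P (X i @^-1` A) = (fine (mu A))%:E.
  by rewrite id// fineK// fin_num_measure.
have PEE i j : i != j -> P (X i @^-1` A `&` X j @^-1` A) =
    (fine (mu A) * fine (mu A))%:E.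
  move=> ij; have := ind [:: i; j] (fun=> A).
  rewrite /= inE andbT ij => /(_ isT (fun=> mA)).
  rewrite !big_cons big_nil mule1 !PE -EFinM => <-.
  congr (P _); apply/seteqP; split => om /=.
    by move=> [? ?] k /=; rewrite !inE => /orP[] /eqP ->.
  by move=> h; split; apply: h; rewrite /= !inE eqxx ?orbT.
by apply: filterS (strong_law_pairwise mE PE PEE e0).
Qed.

Lemma iid_supp : {ae P, forall om j, supp mu (toC (X j om))}.
Proof.
apply: ae_foralln => j; have [N [mN N0 sN]] := supp_ae mu.
exists (X j @^-1` N); split.
- by rewrite -[X in measurable X]setTI; exact: measurable_funPT.
- exact: etrans (iid.1 j N mN) N0.
- by move=> om; apply: sN.
Qed.

Lemma ae_forall_ord K (Q : 'I_K -> Omega -> Prop) :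
  (forall j, {ae P, forall om, Q j om}) -> {ae P, forall om j, Q j om}.
Proof.
move=> h; pose Q' n om := forall j : 'I_K, nat_of_ord j = n -> Q j om.
have : {ae P, forall om n, Q' n om}.
  apply: ae_foralln => n; have [nK|nK] := ltnP n K.
    apply: filterS (h (Ordinal nK)) => om q j jn.
    by rewrite (_ : j = Ordinal nK)//; exact: val_inj.
  by apply: aeW => om j jn; have := ltn_ord j; rewrite jn ltnNge nK.
by apply: filterS => om q j; exact: (q j j).
Qed.

(** The cells are chosen before [z], so finitely many strong laws give one null set and one
    threshold valid for all [z] at once. *)
Lemma uniform_law (eps eta : R) : compact (@toC R @^-1` supp mu) ->
  0 < eps -> 0 < eta ->
  {ae P, forall om, exists N, forall n, (N <= n)%N -> forall z, far mu eps z ->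
    normc (\sum_(i < n) (z - toC (X i om))^-1 - n%:R * cauchy_tr mu z) <=
    eta * n%:R}.
Proof.
move=> cK e0 h0; pose delta := eps ^+ 2 * eta / 6.
have d0 : 0 < delta by rewrite divr_gt0// mulr_gt0// exprn_gt0.
have [K [A [c cells]]] := supp_cells cK d0.
(* [delta] and [e] each account for an error [eta / 2]; [K.+1] avoids a division by zero when there
   are no cells. *)
pose e := eps * eta / (2 * K.+1%:R).
have e'0 : 0 < e by rewrite divr_gt0 ?mulr_gt0.
have mA : forall j, measurable (A j) by case: cells.
have h := ae_forall_ord (fun j => iid_strong_law (mA j) e'0).
apply: filterS2 iid_supp h => om sX /choice[N hN].
exists (\max_j N j)%N => n hn z fz.
apply: le_trans (cell_empirical cells e0 n fz sX) _.
have h1 : \sum_(j < K) `|\sum_(i < n) (\1_(A j) (X i om) - fine (mu (A j)))| <=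
    K.+1%:R * (e * n%:R).
  apply: (@le_trans _ _ (\sum_(j < K) (e * n%:R))).
    by apply: ler_sum => j _; apply: hN; apply: leq_trans hn; exact: leq_bigmax.
  rewrite sumr_const card_ord -[_ *+ K]mulr_natl ler_wpM2r ?ler_nat//.
  by rewrite mulr_ge0// ltW.
have h2 : K.+1%:R * (e * n%:R) / eps = eta / 2 * n%:R.
  rewrite /e; field; rewrite gt_eqF//= pnatr_eq0//.
have h3 : 3 * (eps ^- 2 * delta) * n%:R = eta / 2 * n%:R.
  by rewrite /delta; field; rewrite gt_eqF.
rewrite h3 [leRHS](_ : _ = eta / 2 * n%:R + eta / 2 * n%:R); last by field.
by rewrite lerD2l -h2 ler_wpM2r// invr_ge0 ltW.
Qed.

End UniformLaw.

(** * Pairing of critical points with outlying roots *)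

Lemma ex_nat_ge (R : realType) (D : R) :
  exists Q, forall q, (Q <= q)%N -> D <= q%:R.
Proof.
exists (Num.bound `|D|) => q hq; apply: le_trans (ler_norm D) _.
apply: le_trans (ltW (archi_boundP (normr_ge0 D))) _.
by rewrite ler_nat.
Qed.

Section ProdX.
Variable F : fieldType.
Implicit Types (s t : seq F) (x : F).

Lemma prodX_cat s t : prodX (s ++ t) = prodX s * prodX t.
Proof. exact: big_cat. Qed.

Lemma logder_cat s t z : logder (s ++ t) z = logder s z + logder t z.
Proof. exact: big_cat. Qed.

Lemma prodX_enum (I : finType) (f : I -> F) :
  \prod_(i : I) ('X - (f i)%:P) = prodX [seq f i | i <- enum I].
Proof. by rewrite /prodX big_map big_enum. Qed.

Lemma prodX_iota (f : nat -> F) n :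
  \prod_(i < n) ('X - (f i)%:P) = prodX [seq f i | i <- iota 0 n].
Proof.
rewrite /prodX big_map -(big_mkord xpredT (fun i => 'X - (f i)%:P)).
by rewrite /index_iota subn0.
Qed.

Lemma prodX_filter x s :
  prodX s = ('X - x%:P) ^+ count_mem x s * prodX (seq.filter (predC1 x) s).
Proof.
rewrite /prodX (bigID (pred1 x))/= big_filter; congr (_ * _).
rewrite (eq_bigr (fun=> 'X - x%:P)); last by move=> y /eqP ->.
by rewrite big_const_seq iter_mulr_1.
Qed.

End ProdX.

(* z * logder a z is the sum of 1 + x / (z - x) over the roots x, and the
   fractions have modulus < 1. *)
Lemma logder_neq0_out (R : realType) (a : seq R[i]) (B : R) z :
  (0 < size a)%N -> (forall x, x \in a -> normc x <= B) -> 2 * B < normc z ->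
  logder a z != 0.
Proof.
move=> a0 aB zB.
have B0 : 0 <= B.
  by case: a a0 aB => // x a _ /(_ x (mem_head _ _)); apply: le_trans (normc_ge0 _).
have zB0 : 0 < normc z - B by lra.
pose t := B / (normc z - B).
have t1 : t < 1 by rewrite ltr_pdivrMr// mul1r; lra.
have zx x : x \in a -> normc z - B <= normc (z - x).
  by move=> /aB xB; have := ler_normc_sub z (- x); rewrite normcN; lra.
have h : normc (\sum_(x <- a) x / (z - x)) <= t * (size a)%:R.
  apply: ler_normc_sumconst => x xa; rewrite normcM normcV.
  have hx := zx _ xa.
  apply: ler_pM; rewrite ?normc_ge0 ?aB// ?invr_ge0 ?normc_ge0//.
  by rewrite lef_pV2// posrE (lt_le_trans zB0).
apply/eqP => L0; move: h.
have -> : \sum_(x <- a) x / (z - x) = z * logder a z - (size a)%:R.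
  rewrite /logder mulr_sumr -[size a](count_predT) -sum1_count natr_sum -sumrB.
  rewrite big_seq [RHS]big_seq; apply: eq_bigr => x /zx hx.
  have : z - x != 0 by rewrite -normc_gt0 (lt_le_trans zB0).
  by move=> ?; field.
rewrite L0 mulr0 sub0r normcN normc_nat leNgt => /negP; apply.
by rewrite gtr_pMl// ltr0n.
Qed.

(** * Outlying roots and critical points for a fixed sequence of roots *)

Section Deterministic.
Variables (R : realType) (k s : nat) (xi : 'I_k -> R[i]) (a : nat -> R[i]).
(** [A] stands for [Nbhd mu eps], [r] is the radius of the discs about the outlying roots, [rho]
    bounds from below the distance to the other roots, [B] bounds all roots, and [2 * c] is the
    linear growth rate of the logarithmic derivative. *)
Variables (A : set R[i]) (r rho c B : R) (N0 : nat).
Hypothesis hsk : (s <= k)%N.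
Hypothesis k0 : (0 < k)%N.
Hypotheses (rho0 : 0 < rho) (rhor : rho <= r) (c0 : 0 < c).
Hypothesis xi_in : forall l : 'I_k, (l < s)%N -> forall z : R[i],
  normc (z - xi l) <= r -> ~ A z /\ normc z <= 2 * B.
Hypothesis xi_out : forall l : 'I_k, (s <= l)%N -> forall z : R[i], ~ A z ->
  rho <= normc (z - xi l).
Hypothesis xi_sep : forall l l' : 'I_k, xi l != xi l' ->
  3 * r <= normc (xi l - xi l').
Hypothesis a_out : forall j (z : R[i]), ~ A z -> rho <= normc (z - a j).
Hypothesis xiB : forall l, normc (xi l) <= B.
Hypothesis aB : forall j, normc (a j) <= B.
Hypothesis low : forall n, (N0 <= n)%N -> forall z : R[i], ~ A z -> normc z <= 2 * B ->
  2 * c * n%:R <= normc (\sum_(j < n) (z - a j)^-1).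

Let rs q := [seq a j | j <- iota 0 q].
Let ys := [seq xi l | l <- enum 'I_k].
Let poly n := (\prod_(j < n - k) ('X - (a j)%:P)) * (\prod_(l < k) ('X - (xi l)%:P)).

Let size_ys : size ys = k. Proof. by rewrite size_map size_enum_ord. Qed.

Let polyE n : poly n = prodX (rs (n - k) ++ ys).
Proof.
rewrite prodX_cat; congr (_ * _); first exact: prodX_iota.
exact: prodX_enum.
Qed.

(** At most [k] extra roots at distance [rho] change the sum by at most [k / rho], which the slack
    between [2 * c] and [c] absorbs for large [q]. *)
Let low_logder q (bs : seq R[i]) (z : R[i]) : (N0 <= q)%N -> (size bs <= k)%N -> ~ A z ->
  normc z <= 2 * B -> (forall b : R[i], b \in bs -> rho <= normc (z - b)) ->
  c * k%:R + k%:R / rho <= c * q%:R ->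
  c * (size (rs q ++ bs))%:R <= normc (logder (rs q ++ bs) z).
Proof.
move=> Nq sb oz zB zb hq; rewrite logder_cat.
apply: le_trans (ler_normc_sub _ _).
have h1 : logder (rs q) z = \sum_(j < q) (z - a j)^-1.
  rewrite /logder /rs big_map -(big_mkord xpredT (fun j => (z - a j)^-1)).
  by rewrite /index_iota subn0.
have h2 := low Nq oz zB; rewrite -h1 in h2.
have h3 := logder_le rho0 zb.
have h4 : rho^-1 * (size bs)%:R <= k%:R / rho.
  by rewrite mulrC ler_wpM2r ?invr_ge0 ?(ltW rho0)// ler_nat.
have h5 : c * (size bs)%:R <= c * k%:R by rewrite ler_wpM2l ?(ltW c0)// ler_nat.
rewrite size_cat natrD mulrDr size_map size_iota.
by move: h2 h3 h4 h5 hq; lra.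
Qed.

Let bs (x : R[i]) := seq.filter (predC1 x) ys.
Let mult (x : R[i]) := count_mem x ys.

Let polyF n (x : R[i]) : poly n = ('X - x%:P) ^+ mult x * prodX (rs (n - k) ++ bs x).
Proof. by rewrite polyE !prodX_cat (prodX_filter x ys) mulrCA. Qed.

Let mult_gt0 l : (0 < mult (xi l))%N.
Proof. by rewrite -has_count has_pred1 map_f// mem_enum. Qed.

Let r0 : 0 < r. Proof. exact: lt_le_trans rhor. Qed.

(** Another outlying root is at least [3 r] from [xi l], so at least [2 r] from [z]; for the
    remaining ones [xi_out] applies, [z] being outside [A]. *)
Let bs_far (l : 'I_k) (z b : R[i]) : (l < s)%N -> normc (z - xi l) <= r ->
  b \in bs (xi l) -> rho <= normc (z - b).
Proof.
move=> ls zl; rewrite mem_filter => /andP[/= + /mapP[l' _ e]]; rewrite e => ll'.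
have [oz _] := xi_in ls zl.
have [ls'|/xi_out] := ltnP l' s; last exact.
have := xi_sep ll'; have := ler_normc_dist z (xi l') (xi l).
by rewrite (normcBC (xi l') z); move: rhor rho0 zl; lra.
Qed.

(** A root of multiplicity [mult (xi l)] stays critical with multiplicity one less, and the
    contraction argument supplies one further simple critical point [w] nearby. *)
Let local n (l : 'I_k) : (l < s)%N -> (N0 <= n - k)%N -> (0 < n - k)%N ->
  c * k%:R + k%:R / rho <= c * (n - k)%:R ->
  k%:R / (c * (n - k)%:R) <= r / 2 ->
  k%:R / (c * (n - k)%:R) <= c * rho ^+ 2 / 2 ->
  exists w : R[i], [/\ normc (w - xi l) <= k%:R / (c * (n - k)%:R), w != xi l &
    forall z : R[i], normc (z - xi l) <= r ->
      mup z (poly n)^`() = ((mult (xi l)).-1 * (z == xi l) + (z == w))%N].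
Proof.
move=> ls; set q := (n - k)%N => Nq q0 h1 h2 h3.
have sbs : (size (bs (xi l)) <= k)%N.
  by rewrite -size_ys /bs size_filter count_size.
have sq : (q <= size (rs q ++ bs (xi l)))%N.
  by rewrite size_cat size_map size_iota leq_addr.
have hm : (mult (xi l))%:R / (c * (size (rs q ++ bs (xi l)))%:R) <= k%:R / (c * q%:R).
  apply: ler_pM => //.
  - by rewrite invr_ge0 mulr_ge0// ltW.
  - by rewrite ler_nat -size_ys count_size.
  - rewrite lef_pV2 ?posrE ?mulr_gt0 ?ltr0n//; last exact: leq_trans sq.
    by rewrite ler_wpM2l ?(ltW c0)// ler_nat.
have far_l (z : R[i]) : normc (z - xi l) <= r -> forall b, b \in rs q ++ bs (xi l) ->
    rho <= normc (z - b).
  move=> zl b; rewrite mem_cat => /orP[|/(bs_far ls zl)//].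
  by move=> /mapP[j _ ->]; apply: a_out; exact: (xi_in ls zl).1.
have [|||||||||w [w1 w2 w3]] := @critpoly_unique_root R (rs q ++ bs (xi l)) (xi l)
  (mult (xi l)) r rho c => //.
- exact: leq_trans sq.
- move=> z zl; have [oz zB] := xi_in ls zl.
  by apply: low_logder => // b; exact: bs_far.
- exact: le_trans h2.
- exact: le_trans h3.
exists w; split=> // [|z zl]; first exact: le_trans hm.
have e : (poly n)^`() = ('X - (xi l)%:P) ^+ (mult (xi l)).-1 *
    critpoly (xi l) (mult (xi l)) (rs q ++ bs (xi l)).
  rewrite (polyF n (xi l)); case: (mult (xi l)) (mult_gt0 l) => // m _.
  exact: deriv_XsubCX_prodX.
have H0 : critpoly (xi l) (mult (xi l)) (rs q ++ bs (xi l)) != 0.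
  have xir : normc (xi l - xi l) <= r by rewrite subrr normc0 ltW.
  have xil : xi l \notin rs q ++ bs (xi l).
    by apply/negP => /(far_l _ xir); rewrite subrr normc0 leNgt rho0.
  apply: contraTneq (prodX_neq0 xil) => H0; have := critpolyE (xi l) (mult (xi l)) xil.
  rewrite H0 horner0 subrr mul0r addr0 => /esym/eqP.
  by rewrite mulf_eq0 pnatr_eq0 eqn0Ngt mult_gt0 orbF => ->.
rewrite e mupM ?expf_neq0 ?polyXsubC_eq0// mup_XsubCX w3// eq_sym.
by case: eqP => _; rewrite ?muln1 ?muln0.
Qed.

Let polydE n (z : R[i]) : z \notin rs (n - k) ++ ys ->
  (poly n)^`().[z] = (prodX (rs (n - k) ++ ys)).[z] * logder (rs (n - k) ++ ys) z.
Proof. by move=> h; rewrite polyE deriv_prodX. Qed.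

Let rsB q (x : R[i]) : x \in rs q ++ ys -> normc x <= B.
Proof. by rewrite mem_cat => /orP[] /mapP[j _ ->]. Qed.

Let no_crit_out n (z : R[i]) : 2 * B < normc z -> ~~ root (poly n)^`() z.
Proof.
move=> zB; have zn : z \notin rs (n - k) ++ ys.
  apply/negP => /rsB zB'; have := normc_ge0 z.
  by move: zB zB'; lra.
rewrite /root polydE// mulf_neq0 ?prodX_neq0//.
apply: logder_neq0_out zB; last exact: rsB.
by rewrite size_cat size_ys addn_gt0 k0 orbT.
Qed.

(** Outside the disc of radius [2 * B] this is [no_crit_out]; inside it the logarithmic derivative
    is nonzero by its linear growth. *)
Let no_crit_far n (z : R[i]) : (N0 <= n - k)%N ->
  c * k%:R + k%:R / rho <= c * (n - k)%:R ->
  ~ A z -> (forall l : 'I_k, (l < s)%N -> r < normc (z - xi l)) ->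
  ~~ root (poly n)^`() z.
Proof.
move=> Nq h1 oz zl; have [zB|] := leP (normc z) (2 * B); last exact: no_crit_out.
have zys (b : R[i]) : b \in ys -> rho <= normc (z - b).
  move=> /mapP[l _ ->]; have [/zl|/xi_out] := ltnP l s; last exact.
  by move=> /ltW; apply: le_trans.
have zn : z \notin rs (n - k) ++ ys.
  apply/negP; rewrite mem_cat => /orP[/mapP[j _ zj]|/zys]; last first.
    by rewrite subrr normc0 leNgt rho0.
  by have := a_out j oz; rewrite zj subrr normc0 leNgt rho0.
rewrite /root polydE// mulf_neq0 ?prodX_neq0// -normc_gt0.
apply: lt_le_trans (low_logder Nq _ oz zB zys h1); last by rewrite size_ys.
by rewrite mulr_gt0// ltr0n size_cat size_ys addn_gt0 k0 orbT.
Qed.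

Let multE (x : R[i]) : mult x = (\sum_(l < k | xi l == x) 1)%N.
Proof. by rewrite /mult -sum1_count big_map big_enum_cond. Qed.

(** Among equal outlying roots, the first index is labelled by the displaced critical point and
    every later one by the root itself, which matches the multiplicities found in [local]. *)
Lemma critical_points_near_outliers : exists w : nat -> 'I_s -> R[i],
  (exists N, forall n, (N <= n)%N ->
     crit_outside ((\prod_(j < n - k) ('X - (a j)%:P)) *
                   (\prod_(l < k) ('X - (xi l)%:P))) A (w n)) /\
  (forall e, 0 < e -> exists N, forall n, (N <= n)%N -> forall l,
     normc (w n l - xi (widen_ord hsk l)) < e).
Proof.
have small (D : R) : 0 < D -> exists Q, forall q, (Q <= q)%N ->
    (0 < q)%N /\ k%:R / (c * q%:R) <= D.
  move=> D0; have [Q hQ] := ex_nat_ge (k%:R / (c * D)).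
  exists Q.+1 => q Qq; have q0 : (0 < q)%N by apply: leq_trans Qq.
  split=> //; have := hQ _ (ltnW Qq).
  rewrite ler_pdivrMr ?mulr_gt0// ler_pdivrMr ?mulr_gt0 ?ltr0n//.
  by have -> : D * (c * q%:R) = q%:R * (c * D) by ring.
have [Q1 hQ1] := ex_nat_ge ((c * k%:R + k%:R / rho) / c).
have [Q2 hQ2] := small (r / 2) (divr_gt0 r0 (ltr0Sn _ 1)).
have crho : 0 < c * rho ^+ 2 / 2 by rewrite divr_gt0// mulr_gt0// exprn_gt0.
have [Q3 hQ3] := small _ crho.
pose Q := (N0 + Q1 + Q2 + Q3)%N.
have big n : (Q + k <= n)%N -> [/\ (N0 <= n - k)%N, (0 < n - k)%N,
    c * k%:R + k%:R / rho <= c * (n - k)%:R,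
    k%:R / (c * (n - k)%:R) <= r / 2 & k%:R / (c * (n - k)%:R) <= c * rho ^+ 2 / 2].
  rewrite /Q => hn; split; [lia|apply: (hQ2 _ _).1; lia| |apply: (hQ2 _ _).2; lia|
    apply: (hQ3 _ _).2; lia].
  have := hQ1 (n - k)%N ltac:(lia).
  by rewrite ler_pdivrMr// (mulrC c (n - k)%:R).
(* For an index that is not outlying, or for [n] too small, the value 0 is a mere default. *)
have /choice[wr hwr] : forall nl : nat * 'I_k, exists w : R[i],
    (nl.2 < s)%N -> (Q + k <= nl.1)%N ->
    [/\ normc (w - xi nl.2) <= k%:R / (c * (nl.1 - k)%:R), w != xi nl.2 &
    forall z : R[i], normc (z - xi nl.2) <= r ->
      mup z (poly nl.1)^`() = ((mult (xi nl.2)).-1 * (z == xi nl.2) + (z == w))%N].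
  move=> [n l] /=; have [ls|ls] := boolP (l < s)%N; last by exists 0.
  have [/big[h1 h2 h3 h4 h5]|hn] := boolP (Q + k <= n)%N; last by exists 0.
  by have [w hw] := local ls h1 h2 h3 h4 h5; exists w.
pose isfirst (l : 'I_k) := [forall l' : 'I_k, (l' < l)%N ==> (xi l' != xi l)].
pose w' n (l : 'I_k) := if isfirst l then wr (n, l) else xi l.
have w'near n (l : 'I_k) : (l < s)%N -> (Q + k <= n)%N ->
    normc (w' n l - xi l) <= k%:R / (c * (n - k)%:R).
  move=> ls hn; rewrite /w'; case: ifP => _.
    by have [] := hwr (n, l) ls hn.
  by rewrite subrr normc0 divr_ge0// mulr_ge0// ltW.
exists (fun n l => w' n (widen_ord hsk l)); split; last first.
  move=> e e0; have [Q4 hQ4] := small (e / 2) (divr_gt0 e0 (ltr0Sn _ 1)).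
  exists (Q + k + Q4)%N => n hn l.
  apply: le_lt_trans (w'near n (widen_ord hsk l) (ltn_ord l) _) _.
    by move: hn; lia.
  have [_] := hQ4 (n - k)%N ltac:(lia).
  by move=> /le_lt_trans; apply; lra.
exists (Q + k)%N => n hn; have [Nq q0 h1 h2 h3] := big n hn.
have w'r (l : 'I_k) : (l < s)%N -> normc (w' n l - xi l) <= r / 2.
  by move=> ls; apply: le_trans (w'near n l ls hn) h2.
(* The derivative does not vanish at [2 * |B| + 1], a point beyond the region of critical points. *)
have pd0 : (poly n)^`() != 0.
  have : 2 * B < normc ((2 * `|B| + 1)%:C%C : R[i]).
    rewrite normcR ger0_norm ?addr_ge0 ?mulr_ge0//.
    by have := ler_norm B; lra.
  by move=> /(no_crit_out n); apply: contraNneq => ->; exact: root0.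
split=> //; split.
  move=> l; apply: (xi_in (l := widen_ord hsk l) (ltn_ord l) _).1.
  by apply: le_trans (w'r (widen_ord hsk l) (ltn_ord l)) _; move: r0; lra.
move=> z oz; rewrite -/(poly n).
have -> : #|[pred l | w' n (widen_ord hsk l) == z]| =
    (\sum_(l < k | (l < s)%N) (w' n l == z))%N.
  rewrite (big_ord_narrow hsk) -sum1_card big_mkcond /=.
  by apply: eq_bigr => l _; rewrite inE; case: eqP.
have [[l0 l0s zl0]|zfar] := pselect (exists2 l : 'I_k, (l < s)%N & normc (z - xi l) <= r);
    last first.
  rewrite mupNroot; last first.
    apply: no_crit_far => // l ls; rewrite ltNge; apply/negP => zl.
    by apply: zfar; exists l.
  rewrite big1// => l ls; apply/eqP; rewrite eqb0; apply/eqP => wz; apply: zfar.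
  by exists l => //; have := w'r l ls; rewrite wz; move: r0; lra.
(* [l1] is the first index carrying the outlying root close to [z]. *)
have [l1 /eqP l1e l1min] := @arg_minnP _ l0
  (fun l => xi l == xi l0) (@nat_of_ord k) (eqxx _).
have l1s : (l1 < s)%N by apply: leq_ltn_trans l0s; exact: l1min.
(* A label attached to another outlying root is too far away to equal [z]; conversely, every index
   carrying the root [xi l1] is itself outlying, by [xi_out]. *)
have -> : (\sum_(l < k | (l < s)%N) (w' n l == z) =
    \sum_(l < k | xi l == xi l1) (w' n l == z))%N.
  rewrite big_mkcond [RHS]big_mkcond /=; apply: eq_bigr => l _.
  have [ls|ls] := boolP (l < s)%N; have [ll|ll] := eqVneq (xi l) (xi l1) => //.
    apply/eqP; rewrite eqb0; apply/eqP => wz; have := w'r l ls.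
    have := xi_sep ll; have := ler_normc_dist z (xi l) (xi l1).
    by rewrite wz l1e (normcBC (xi l) z); move: r0 zl0; lra.
  exfalso; move: ls; rewrite -leqNgt => /xi_out h.
  have /h : ~ A (xi l1).
    by apply: (xi_in l1s _).1; rewrite subrr normc0 ltW.
  by rewrite ll subrr normc0 leNgt rho0.
have w'1 : w' n l1 = wr (n, l1).
  rewrite /w' ifT//; apply/forallP => l'; apply/implyP => l'1; apply/eqP => e.
  by move: l'1; rewrite ltnNge l1min// e l1e.
rewrite (bigD1 l1)//= w'1.
(* The remaining [mult (xi l1) - 1] indices are not first, so their label is the root itself. *)
rewrite (eq_bigr (fun=> nat_of_bool (xi l1 == z))); last first.
  move=> l /andP[/eqP le ll]; rewrite /w'.
  case: ifP => [/forallP /(_ l1)|_]; last by rewrite le.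
  rewrite le eqxx implybF -leqNgt => ll1; exfalso; move/negP: ll; apply.
  by apply/eqP/val_inj/eqP; rewrite eqn_leq ll1 l1min// le l1e.
have [_ _ ->] := hwr (n, l1) l1s hn; last by rewrite /= l1e.
rewrite /= addnC [z == _]eq_sym [z == _]eq_sym; congr (_ + _)%N.
have -> : mult (xi l1) = (\sum_(i < k | (xi i == xi l1) && (i != l1)) 1).+1.
  by rewrite multE (bigD1 l1) ?eqxx.
by rewrite /= big_distrl /=; apply: eq_bigr => i _; rewrite mul1n.
Qed.

End Deterministic.

(** * Choice of the constants and the almost sure statement *)

Lemma ex_common_pos (R : realType) (I : finType) (Q : I -> R -> Prop) :
  (forall i, exists2 e, 0 < e & Q i e) ->
  (forall i e e', e' <= e -> Q i e -> Q i e') ->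
  exists2 e, 0 < e & forall i, Q i e.
Proof.
move=> /(_ _)/cid2 - /all_sig2[e e0 Qe] Qle.
have S0 (P : pred I) : 0 <= \sum_(i | P i) (e i)^-1.
  by rewrite sumr_ge0// => i _; rewrite invr_ge0 ltW.
(* A positive lower bound of all the [e i] that also makes sense for an empty index type. *)
exists (1 + \sum_i (e i)^-1)^-1; first by rewrite invr_gt0 ltr_wpDr.
move=> i; apply: Qle (Qe i); rewrite -[leRHS]invrK lef_pV2 ?posrE ?invr_gt0//.
  by rewrite (bigD1 i)//= addrCA lerDl addr_ge0// S0.
by rewrite ltr_wpDr// S0.
Qed.

Lemma supp_bounded (R : realType) (mu : probability (R * R)%type R) :
  compact (@toC R @^-1` supp mu) ->
  exists B : R, forall y, supp mu (toC y) -> normc (toC y) <= B.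
Proof.
move=> cK; have [K [A [c [_ _ cov]]]] := supp_cells cK (ltr01 : 0 < 1 :> R).
exists (1 + \sum_i normc (toC (c i))) => y /cov[i [_ yc]].
have := ler_normc_dist (toC (c i)) (toC y) 0; rewrite !subr0.
have : normc (toC (c i)) <= \sum_i normc (toC (c i)).
  by rewrite (bigD1 i)//= lerDl sumr_ge0// => j _; exact: normc_ge0.
by lra.
Qed.

Theorem mainTheorem4 (R : realType) (d : measure_display)
  (Omega : measurableType d) (P : probability Omega R)
  (mu : probability (R * R)%type R)
  (X : nat -> {mfun Omega >-> (R * R)%type})
  (k s : nat) (xi : 'I_k -> R[i]) (hk : (1 <= k)%N) (hsk : (s <= k)%N) :
  compact (@toC R @^-1` supp mu) ->
  iid_with P X mu ->
  (forall l : 'I_k, (l < s)%N <-> ~ (supp mu `|` Mzeros mu) (xi l)) ->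
  exists eps0 : R, 0 < eps0 /\
    forall eps : R, 0 < eps -> eps < eps0 ->
      {ae P, forall om,
        exists w : nat -> 'I_s -> R[i],
          (exists N : nat, forall n : nat, (N <= n)%N ->
             crit_outside (pn (fun j => X j) xi n om) (Nbhd mu eps) (w n)) /\
          (forall e : R, 0 < e -> exists N : nat, forall n : nat, (N <= n)%N ->
             forall l : 'I_s, `|w n l - xi (widen_ord hsk l)| < (e%:C)%C)}.
Proof.
move=> cK iid hxi; set F := supp mu `|` Mzeros mu in hxi.
(* [eps0] bounds from below the distances of the outlying roots to [F]; these are positive by
   [supp_Mzeros_open]. *)
have [eps0 eps00 xiF] : exists2 eps0 : R, 0 < eps0 &
    forall l : 'I_k, (l < s)%N -> forall w, F w -> eps0 <= normc (xi l - w).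
  apply: ex_common_pos => [l|l e e' ee' h ls w Fw]; last exact: le_trans (h ls w Fw).
  have [/hxi/supp_Mzeros_open[e e0 h]|ls] := boolP (l < s)%N; last by exists 1.
  by exists e.
have [sep sep0 xisep] : exists2 sep : R, 0 < sep &
    forall ll : 'I_k * 'I_k, xi ll.1 != xi ll.2 -> sep <= normc (xi ll.1 - xi ll.2).
  apply: ex_common_pos => [ll|ll e e' ee' h /h]; last exact: le_trans.
  have [ee|ne] := eqVneq (xi ll.1) (xi ll.2); first by exists 1.
  by exists (normc (xi ll.1 - xi ll.2)); rewrite ?normc_gt0 ?subr_eq0.
have [B1 hB1] := supp_bounded cK.
exists eps0; split=> // eps e0 eeps0.
(* The first bound keeps the discs about outlying roots outside [Nbhd mu eps], the second keeps
   distinct outlying roots [3 r] apart. *)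
pose r := Num.min (eps0 - eps) (sep / 3).
have r0 : 0 < r by rewrite lt_min subr_gt0 eeps0 divr_gt0.
have reps : r <= eps0 - eps by rewrite ge_min lexx.
have rsep : r <= sep / 3 by rewrite ge_min lexx orbT.
pose rho := Num.min eps r.
have rho0 : 0 < rho by rewrite lt_min e0.
have rhor : rho <= r by rewrite ge_min lexx orbT.
have rhoe : rho <= eps by rewrite ge_min lexx.
(* The summand [r] places the whole discs about the [xi l] in the region where the transform is
   bounded below. *)
pose B := `|B1| + \sum_l normc (xi l) + r.
have sxi0 : 0 <= \sum_l normc (xi l) by rewrite sumr_ge0// => l _; exact: normc_ge0.
have xiB l : normc (xi l) + r <= B.
  rewrite lerD2r ler_wpDl// (bigD1 l)//= lerDl sumr_ge0// => j _.
  exact: normc_ge0.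
have [c c0 hc] := cauchy_tr_bounded_below mu (2 * B) e0.
(* The uniform law is used with error [c / 2], which leaves [c n - c n / 2 = 2 (c / 4) n] as lower
   bound for the empirical sum. *)
have c40 : 0 < c / 4 by rewrite divr_gt0.
apply: filterS2 (iid_supp iid) (uniform_law iid cK e0 (divr_gt0 c0 (ltr0Sn _ 1))).
move=> om sX [N0 hN0].
have [w [w1 w2]] : exists w : nat -> 'I_s -> R[i],
    (exists N, forall n, (N <= n)%N ->
     crit_outside (pn (fun j => X j) xi n om) (Nbhd mu eps) (w n)) /\
    (forall e, 0 < e -> exists N, forall n, (N <= n)%N -> forall l,
      normc (w n l - xi (widen_ord hsk l)) < e).
  apply: (@critical_points_near_outliers R k s xi (fun j => toC (X j om))
    (Nbhd mu eps) r rho (c / 4) B N0 hsk hk rho0 rhor c40).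
  - move=> l ls z zl; split.
      apply/notin_Nbhd => w Fw; have := xiF l ls w Fw.
      by have := ler_normc_dist z (xi l) w; rewrite (normcBC (xi l) z); lra.
    have := ler_normcD (z - xi l) (xi l); rewrite subrK.
    by have := xiB l; have := normc_ge0 (xi l); lra.
  - move=> l ls z /notin_Nbhd oz; apply: le_trans rhoe _; apply: oz.
    by apply: contrapT => /hxi; rewrite ltnNge ls.
  - by move=> l l' /(xisep (l, l')) /=; lra.
  - by move=> j z /notin_Nbhd oz; apply: le_trans rhoe _; apply: oz; left.
  - by move=> l; have := xiB l; lra.
  - move=> j; have := hB1 _ (sX j); have := ler_norm B1; rewrite /B; lra.
  move=> n Nn z oz zB; have := hc z oz zB.
  have fz : far mu eps z.
    by move=> w sw; apply: ((notin_Nbhd mu eps z).1 oz); left.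
  have := hN0 n Nn z fz.
  set S := \sum_(i < n) _; set m := cauchy_tr mu z => h1 h2.
  have := ler_normc_sub (n%:R * m) (S - n%:R * m).
  rewrite normcM normc_nat subrKC.
  have := ler_wpM2r (ler0n R n) h2.
  by move: h1; lra.
exists w; split=> // e /w2[N hN]; exists N => n Nn l; rewrite normc_lt.
exact: hN.
Qed.
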